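(* Let $G=G_+\cup G_-$ be a finite abelian group, where $G_+=\{g_1,\dots,g_k\}$ and $G_-=\{g_{k+1},\dots,g_r\}$ (with $r=k$ or $r=2k$), and let $L=L(X)$ be a free color Lie superalgebra freely generated by a set $X=X_{g_1}\cup\cdots\cup X_{g_r}$ with $|X_{g_i}|=s_i$, $1\le s_i<\infty$, for $i=1,\dots,r$. Then for every $\alpha=(\alpha_1,\dots,\alpha_r)\in\mathbb{N}_0^r\setminus\{0\}$, $$\dim L_\alpha=\frac{(-1)^{|\alpha|_-}}{|\alpha|}\sum_{n\mid\alpha}\mu(n)\,\frac{\left(\frac{|\alpha|}{n}\right)!\,(-1)^{\frac{|\alpha|_-}{n}}}{\left(\frac{\alpha_1}{n}\right)!\cdots\left(\frac{\alpha_r}{n}\right)!}\,s_1^{\frac{\alpha_1}{n}}\cdots s_r^{\frac{\alpha_r}{n}}.$$ In particular, if $L$ is a free Lie algebra (i.e. $G$ is trivial, $r=k=1$, with $s_1$ free generators), this is the classical Witt formula $\dim L_n=\frac1n\sum_{d\mid n}\mu(d)s_1^{n/d}$, $n\ge1$.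
   Context: $\mathbb{N}=\{1,2,\dots\}$, $\mathbb{N}_0=\mathbb{N}\cup\{0\}$, $\mu$ is the Möbius function. Color Lie superalgebras: $G$ is an abelian group (written multiplicatively), $F$ a field, $\gamma:G\times G\to F^{\times}$ a bicharacter with $\gamma(g,h)\gamma(h,g)=1$; $G_+=\{g:\gamma(g,g)=1\}$ and $G_-=G\setminus G_+$. A color Lie superalgebra is a $G$-graded space $L=\bigoplus_{g\in G}L_g$ with a bilinear bracket, $[L_g,L_h]\subseteq L_{gh}$, such that for $x\in L_g$, $y\in L_h$, $z\in L$: $[x,y]=-\gamma(g,h)[y,x]$ and $[x,[y,z]]=[[x,y],z]+\gamma(g,h)[y,[x,z]]$; moreover $[x,x]=0$ for $x\in L_g$, $g\in G_+$, and $[x,[x,x]]=0$ for $x\in L_g$, $g\in G_-$ (automatic unless the characteristic is 2, respectively 3). The free color Lie superalgebra $L(X)$ on a $G$-graded set $X=\bigcup_{g}X_g$ (elements of $X_g$ have $G$-degree $g$) is defined by the usual universal property for $G$-degree-preserving maps. Multidegree: $L(X)$ is $\mathbb{N}_0^r$-graded by giving each $x\in X_{g_i}$ the weight $\lambda_i=(0,\dots,0,1,0,\dots,0)$ (1 in the $i$th place); $L_\alpha$ is the homogeneous component of multidegree $\alpha$. For $\alpha\in\mathbb{N}_0^r$: $|\alpha|=\alpha_1+\cdots+\alpha_r$, $|\alpha|_-=\alpha_{k+1}+\cdots+\alpha_r$. The notation $n\mid\alpha$ means that the positive integer $n$ divides all components $\alpha_i$. *)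

(* Defs.v *)
From HB Require Import structures.
From mathcomp Require Import all_boot all_order all_algebra all_fingroup.

Set Implicit Arguments.
Unset Strict Implicit.
Unset Printing Implicit Defensive.

Import Order.TTheory GRing.Theory Num.Theory.
Local Open Scope ring_scope.

(* The grading group [G] is the whole type [gT]. *)

Record color_bicharacter (F : fieldType) (gT : finGroupType)
    (gamma : gT -> gT -> F) : Prop := ColorBicharacter {
  bichar_neq0 : forall g h, gamma g h != 0;
  bicharMl : forall g g' h, gamma (g * g')%g h = gamma g h * gamma g' h;
  bicharMr : forall g h h', gamma g (h * h')%g = gamma g h * gamma g h';
  bichar_skew : forall g h, gamma g h * gamma h g = 1
}.

Definition Gplus (F : fieldType) (gT : finGroupType) (gamma : gT -> gT -> F) :
  {set gT} := [set g | gamma g g == 1].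

Definition Gminus (F : fieldType) (gT : finGroupType) (gamma : gT -> gT -> F) :
  {set gT} := ~: Gplus gamma.

Definition is_subspace (F : fieldType) (V : lmodType F) (U : V -> Prop) : Prop :=
  U 0 /\ forall (a : F) (x y : V), U x -> U y -> U (a *: x + y).

(* [V] is the (internal) direct sum of the [C g]; all families are finitely
   supported since the group is finite. *)
Definition is_grading (F : fieldType) (gT : finGroupType) (V : lmodType F)
    (C : gT -> V -> Prop) : Prop :=
  (forall g, is_subspace (C g)) /\
  forall x : V, exists! c : {ffun gT -> V},
    (forall g, C g (c g)) /\ x = \sum_g c g.

Record colorLieSuper (F : fieldType) (gT : finGroupType)
    (gamma : gT -> gT -> F) := ColorLieSuper {
  cls_mod :> lmodType F;
  cls_comp : gT -> cls_mod -> Prop;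
  cls_br : cls_mod -> cls_mod -> cls_mod;
  cls_grading : is_grading cls_comp;
  cls_brl : forall (a : F) (x y z : cls_mod),
    cls_br (a *: x + y) z = a *: cls_br x z + cls_br y z;
  cls_brr : forall (a : F) (x y z : cls_mod),
    cls_br z (a *: x + y) = a *: cls_br z x + cls_br z y;
  cls_br_comp : forall g h x y,
    cls_comp g x -> cls_comp h y -> cls_comp (g * h)%g (cls_br x y);
  cls_skew : forall g h x y, cls_comp g x -> cls_comp h y ->
    cls_br x y = - (gamma g h *: cls_br y x);
  cls_jacobi : forall g h x y z, cls_comp g x -> cls_comp h y ->
    cls_br x (cls_br y z)
      = cls_br (cls_br x y) z + gamma g h *: cls_br y (cls_br x z);
  cls_brxx : forall g x, g \in Gplus gamma -> cls_comp g x -> cls_br x x = 0;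
  cls_brxxx : forall g x, g \in Gminus gamma -> cls_comp g x ->
    cls_br x (cls_br x x) = 0
}.

Definition cls_morphism (F : fieldType) (gT : finGroupType)
    (gamma : gT -> gT -> F) (L M : colorLieSuper gamma)
    (f : {linear L -> M}) : Prop :=
  (forall g x, cls_comp g x -> cls_comp g (f x)) /\
  (forall x y, f (cls_br x y) = cls_br (f x) (f y)).

(* The [G]-graded set is [X] with degree map [deg], so that [X_g] is the fibre
   of [deg] over [g]. *)
Definition degree_preserving (F : fieldType) (gT : finGroupType)
    (gamma : gT -> gT -> F) (X : Type) (deg : X -> gT)
    (L : colorLieSuper gamma) (phi : X -> L) : Prop :=
  forall x, cls_comp (deg x) (phi x).

Definition is_free_cls (F : fieldType) (gT : finGroupType)
    (gamma : gT -> gT -> F) (X : Type) (deg : X -> gT)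
    (L : colorLieSuper gamma) (iota : X -> L) : Prop :=
  degree_preserving deg iota /\
  forall (M : colorLieSuper gamma) (phi : X -> M), degree_preserving deg phi ->
    exists f : {linear L -> M},
      [/\ cls_morphism f,
          forall x, f (iota x) = phi x
        & forall f' : {linear L -> M}, cls_morphism f' ->
            (forall x, f' (iota x) = phi x) -> f' =1 f].

(* [multicomp g deg iota alpha] is [L_alpha], the span of the bracket monomials
   of multidegree [alpha] in the generators, a generator of degree [g i] having
   weight the [i]-th unit vector. *)
Inductive multicomp (F : fieldType) (gT : finGroupType)
    (gamma : gT -> gT -> F) (r : nat) (g : 'I_r -> gT) (X : Type)
    (deg : X -> gT) (L : colorLieSuper gamma) (iota : X -> L) :
    {ffun 'I_r -> nat} -> L -> Prop :=
| Multicomp_gen (i : 'I_r) (x : X) : deg x = g i ->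
    multicomp g deg iota [ffun j => (j == i : nat)] (iota x)
| Multicomp_br (alpha beta : {ffun 'I_r -> nat}) (x y : L) :
    multicomp g deg iota alpha x -> multicomp g deg iota beta y ->
    multicomp g deg iota [ffun j => (alpha j + beta j)%N] (cls_br x y)
| Multicomp_0 (alpha : {ffun 'I_r -> nat}) : multicomp g deg iota alpha 0
| Multicomp_lin (alpha : {ffun 'I_r -> nat}) (a : F) (x y : L) :
    multicomp g deg iota alpha x -> multicomp g deg iota alpha y ->
    multicomp g deg iota alpha (a *: x + y).

(* [d] is the dimension of the subspace [U]: there is a basis with [d] vectors. *)
Definition has_dim (F : fieldType) (V : lmodType F) (U : V -> Prop) (d : nat) :
    Prop :=
  exists e : 'I_d -> V,
    [/\ forall i, U (e i),
        forall c : 'I_d -> F, \sum_i c i *: e i = 0 -> forall i, c i = 0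
      & forall v, U v -> exists c : 'I_d -> F, v = \sum_i c i *: e i].

Definition moebius (n : nat) : int :=
  if (0 < n)%N && all (fun p => logn p n == 1%N) (primes n)
  then (-1) ^+ size (primes n) else 0.

Definition mabs (r : nat) (alpha : {ffun 'I_r -> nat}) : nat :=
  (\sum_(i < r) alpha i)%N.

(* 0-based indices: the odd part of the group is [g i] with [k <= i < r]. *)
Definition mabs_minus (r k : nat) (alpha : {ffun 'I_r -> nat}) : nat :=
  (\sum_(i < r | k <= i) alpha i)%N.

Definition mdvd (r n : nat) (alpha : {ffun 'I_r -> nat}) : bool :=
  [forall i, (n %| alpha i)%N].

(* Main.v *)
Require Import Defs.
From HB Require Import structures.
From mathcomp Require Import all_boot all_order all_algebra all_fingroup.
From mathcomp Require Import ring mpoly.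
Set Implicit Arguments.
Unset Strict Implicit.
Unset Printing Implicit Defensive.
Import Order.TTheory GRing.Theory Num.Theory.
Local Open Scope ring_scope.

(** The proof replaces the PBW theorem by Lazard elimination and a dimension count.

    Elimination.  Let a color Lie superalgebra be generated by homogeneous elements
    [x] and [S].  Since [ad x] is a color derivation, the algebra is spanned by [x],
    by [[x,x]] when [x] is odd, and by the subalgebra generated by the elements
    [ad(x)^i y], [y] in [S] ([lieSpan_step]).  In the same way an associative algebra
    generated by [x] and [S] is the sum of the spaces [B x^j], where [B] is generated
    by the [ad(x)^i y] ([algSpan_step]).  Eliminating generators one after the other,
    in all weights up to a bound [N], gives a finite list [x_1, x_2, ...] such that the
    [x_i] and the [[x_i,x_i]] with [x_i] odd span the Lie algebra
    ([elimination_lieSpan]), while the ordered monomials in the [x_i] span the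
    associative algebra ([elimination_algSpan]).

    Counting.  If [P] is the generating function of the weights of the generators, one
    elimination step reads [1 - P = (1 - t^w)(1 - P')].  Hence, modulo total degree
    above [N], [1 - sum_i s_i t_i] is the product of the [1 - t^(w_i)] over the weights
    [w_i] of the [x_i] ([elimination_genfun]).  The generating function of the ordered
    monomials is the inverse of this product, so there are as many of them as words in
    the free generators ([count_monomials]).

    Independence.  By the universal property the free algebra maps to matrices with the
    color commutator, each generator acting on words by left multiplication.  The
    ordered monomials applied to the empty word span the space of words of length at
    most [N], and their number is its dimension; so they are independent
    ([monomials_free]).  The image of [x_i] and half the image of [[x_i,x_i]] occur
    among them, so the spanning family of the first paragraph is a basis
    ([multicomp_has_dim]).

    The formula.  Let [c_m] be the number of [x_i] of weight [m].  The logarithmic Euler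
    derivative of the product formula gives
    [sum_(d | m) (|m| / d) c_(m / d) = word_count m] ([word_count_divisors]), whence
    [|m| c_m] by Moebius inversion.  The dimension in multidegree [m] is [c_m], plus
    [c_(m / 2)] when [m / 2] is an odd multidegree, and this extra term is what the
    signs in the statement produce ([signed_moebius_sum]). *)

(** * Elimination of one generator in a color Lie superalgebra *)

Section Elimination.

Variables (F : fieldType) (gT : finGroupType) (gamma : gT -> gT -> F).
Hypotheses (abG : abelian [set: gT]) (bichar : color_bicharacter gamma).
Variables (r : nat) (g : 'I_r -> gT).

Local Notation weight := 'X_{1..r}.

(** The [G]-degree of a bracket monomial of multidegree [m]. *)
Definition gdeg (m : weight) : gT := (\prod_(i < r) g i ^+ m i)%g.

Lemma addmCA (m n p : weight) : (m + (n + p) = n + (m + p))%MM.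
Proof. by rewrite !addmA (addmC m). Qed.

Lemma mulgC_ab (a b : gT) : (a * b = b * a)%g.
Proof. by apply: (centsP abG); rewrite in_setT. Qed.

Lemma gdeg0 : gdeg 0%MM = 1%g.
Proof. by rewrite /gdeg big1 // => i _; rewrite mnm0E expg0. Qed.

Lemma gdegD m n : gdeg (m + n)%MM = (gdeg m * gdeg n)%g.
Proof.
rewrite /gdeg; apply: (big_rec3 (fun a b c => c = a * b)%g); first by rewrite mulg1.
move=> i a b c _ ->; rewrite mnmDE expgD !mulgA; congr (_ * _)%g.
by rewrite -!mulgA; congr (_ * _)%g; exact: mulgC_ab.
Qed.

Lemma gdegU i : gdeg U_(i)%MM = g i.
Proof.
rewrite /gdeg (big_only1 i) //= ?mnm1E ?eqxx ?expg1 // => j ji _.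
by rewrite mnm1E eq_sym (negPf ji) expg0.
Qed.

Lemma gamma1l h : gamma 1%g h = 1.
Proof.
by apply: (mulfI (bichar_neq0 bichar 1%g h)); rewrite -(bicharMl bichar) mulg1 mulr1.
Qed.

Lemma gamma1r h : gamma h 1%g = 1.
Proof.
by apply: (mulfI (bichar_neq0 bichar h 1%g)); rewrite -(bicharMr bichar) mulg1 mulr1.
Qed.

Lemma gamma_minus h : h \in Gminus gamma -> gamma h h = -1.
Proof.
rewrite /Gminus /Gplus !inE => h1; apply/eqP; rewrite -addr_eq0.
have : (gamma h h - 1) * (gamma h h + 1) == 0.
  by rewrite -subr_sqr expr1n expr2 (bichar_skew bichar) subrr.
by rewrite mulf_eq0 subr_eq0 (negPf h1).
Qed.

(** An element of [G_-] can exist only when the characteristic is not 2. *)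
Lemma Gminus_neq2 h : h \in Gminus gamma -> 2%:R != 0 :> F.
Proof.
move=> hm; have := hm; rewrite /Gminus /Gplus !inE; apply: contraNneq => two0.
by rewrite (gamma_minus hm) -subr_eq0 -opprD oppr_eq0 -[1 + 1]/2%:R two0.
Qed.

Variable L : colorLieSuper gamma.
Implicit Types (m n w : weight) (x y z : L) (S : seq (weight * L)).

Lemma brDl x y z : cls_br (x + y) z = cls_br x z + cls_br y z.
Proof. by have := cls_brl 1 x y z; rewrite !scale1r. Qed.

Lemma br0l x : cls_br 0 x = 0.
Proof. by apply: (addrI (cls_br 0 x)); rewrite -brDl !addr0. Qed.

Lemma brDr x y z : cls_br z (x + y) = cls_br z x + cls_br z y.
Proof. by have := cls_brr 1 x y z; rewrite !scale1r. Qed.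

Lemma br0r x : cls_br x 0 = 0.
Proof. by apply: (addrI (cls_br x 0)); rewrite -brDr !addr0. Qed.

Lemma comp_subspace h : is_subspace (@cls_comp _ _ _ L h).
Proof. by case: (cls_grading L) => H _; exact: H. Qed.

Lemma comp0 h : cls_comp h (0 : L).
Proof. by case: (comp_subspace h). Qed.

Lemma compL h a x y : cls_comp h x -> cls_comp h y -> cls_comp h (a *: x + y).
Proof. by case: (comp_subspace h) => _; apply. Qed.

(** Elements of weight [m] of the linear span of a list of weighted vectors. *)
Inductive wspan (V : lmodType F) (S : seq (weight * V)) : weight -> V -> Prop :=
| WspanGen m v : (m, v) \in S -> wspan S m v
| Wspan0 m : wspan S m 0
| WspanLin m a u v : wspan S m u -> wspan S m v -> wspan S m (a *: u + v).

(** Weight [m] part of the subalgebra generated by the weighted elements of [S]: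
    the span of the bracket monomials of weight [m] in [S]. *)
Inductive lieSpan S : weight -> L -> Prop :=
| LieGen m x : (m, x) \in S -> lieSpan S m x
| LieBr m n x y : lieSpan S m x -> lieSpan S n y ->
    lieSpan S (m + n)%MM (cls_br x y)
| Lie0 m : lieSpan S m 0
| LieLin m a x y : lieSpan S m x -> lieSpan S m y -> lieSpan S m (a *: x + y).

(** The weights in [S] determine the [G]-degrees of the elements of [S]. *)
Definition homogeneous S := forall m x, (m, x) \in S -> cls_comp (gdeg m) x.

Definition ad_iter x i y : L := iter i (cls_br x) y.

(** The generators [ad(x)^i y], for [y] in [S], that replace [x] (of weight [w]) and
    [S] when [x] is eliminated.  Those of total weight above [N] are discarded: only
    weights up to [N] matter in the end, and the list must stay finite. *)
Definition elim_gens (N : nat) w x S : seq (weight * L) :=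
  [seq p <- [seq ((p.1 + w *+ i)%MM, ad_iter x i p.2) | p <- S, i <- iota 0 N.+1]
     | mdeg p.1 <= N]%N.

Lemma lieSpanZ S m a x : lieSpan S m x -> lieSpan S m (a *: x).
Proof. by move=> Sx; rewrite -[_ *: _]addr0; apply: LieLin Sx _; apply: Lie0. Qed.

Lemma lieSpanD S m x y : lieSpan S m x -> lieSpan S m y -> lieSpan S m (x + y).
Proof. by move=> Sx Sy; rewrite -[x]scale1r; apply: LieLin. Qed.

Lemma lieSpan_comp S m x : homogeneous S -> lieSpan S m x -> cls_comp (gdeg m) x.
Proof.
move=> hS; elim=> {m x} [m x /hS //|m n x y _ IHx _ IHy|m|m a x y _ IHx _ IHy].
- by rewrite gdegD; exact: cls_br_comp.
- exact: comp0.
- exact: compL.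
Qed.

Lemma elim_gensP N w x S m z : (0 < mdeg w)%N ->
  reflect (exists v y i, [/\ (v, y) \in S, m = (v + w *+ i)%MM, z = ad_iter x i y
                          & (mdeg m <= N)%N])
          ((m, z) \in elim_gens N w x S).
Proof.
move=> w0; rewrite /elim_gens mem_filter.
apply: (iffP andP) => [[mN /allpairsP[[[v y] i] [Sy _ [em ez]]]]|].
  by exists v, y, i.
case=> v [y [i [Sy em ez mN]]]; split=> //; apply/allpairsP.
exists ((v, y), i); split; [exact: Sy| |by rewrite em ez].
rewrite mem_iota add0n ltnS; apply: leq_trans mN; rewrite em mdegD mdegMn.
by rewrite (leq_trans _ (leq_addl _ _)) // leq_pmull.
Qed.

Section Step.

Variables (N : nat) (w : weight) (x : L) (S : seq (weight * L)).
Hypotheses (w_gt0 : (0 < mdeg w)%N) (x_comp : cls_comp (gdeg w) x).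
Hypothesis S_homog : homogeneous S.

Local Notation S' := (elim_gens N w x S).

Lemma elim_gens_homog : homogeneous S'.
Proof.
move=> m z /(elim_gensP _ _ _ _ _ w_gt0)[v [y [i [Sy -> -> _]]]].
elim: i => [|i IHi]; first by rewrite mulm0n addm0; exact: S_homog.
by rewrite mulmS addmCA gdegD; apply: cls_br_comp x_comp _; exact: IHi.
Qed.

(** The subalgebra generated by the new generators is stable under [ad x], since
    [ad x] is a color derivation that sends [ad(x)^i y] to [ad(x)^(i+1) y]. *)
Lemma lieSpan_ad m z : lieSpan S' m z -> (mdeg (w + m) <= N)%N ->
  lieSpan S' (w + m)%MM (cls_br x z).
Proof.
elim=> {m z} [m z Sz|m n y z Sy IHy Sz IHz|m|m a y z _ IHy _ IHz] mN.
- case/(elim_gensP _ _ _ _ _ w_gt0): Sz => v [y [i [Sy em ez _]]].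
  apply: LieGen; apply/(elim_gensP _ _ _ _ _ w_gt0); exists v, y, i.+1.
  by split=> //; rewrite ?ez // em mulmS addmCA.
- rewrite !mdegD in mN IHy IHz.
  rewrite (cls_jacobi z x_comp (lieSpan_comp elim_gens_homog Sy)).
  apply: lieSpanD; [rewrite addmA|apply: lieSpanZ; rewrite addmCA];
    apply: LieBr => //; [apply: IHy|apply: IHz]; apply: leq_trans mN; rewrite leq_add2l.
  + exact: leq_addr.
  + exact: leq_addl.
- by rewrite br0r; exact: Lie0.
- by rewrite cls_brr; apply: LieLin; [exact: IHy|exact: IHz].
Qed.

(** The span of [x], of [[x,x]] when [x] is odd, and of the subalgebra generated by
    the new generators. *)
Inductive step_span : weight -> L -> Prop :=
| Step_x : step_span w x
| Step_xx : gdeg w \in Gminus gamma -> step_span (w + w)%MM (cls_br x x)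
| Step_S m z : lieSpan S' m z -> step_span m z
| Step_0 m : step_span m 0
| Step_lin m a y z : step_span m y -> step_span m z -> step_span m (a *: y + z).

Lemma step_spanZ m a y : step_span m y -> step_span m (a *: y).
Proof. by move=> Sy; rewrite -[_ *: _]addr0; apply: Step_lin Sy _; apply: Step_0. Qed.

Lemma step_ad m z : step_span m z -> (mdeg (w + m) <= N)%N ->
  step_span (w + m)%MM (cls_br x z).
Proof.
elim=> {m z} [|wm|m z Sz|m|m a y z _ IHy _ IHz] mN.
- have [wp|wm] := boolP (gdeg w \in Gplus gamma).
    by rewrite (cls_brxx wp x_comp); exact: Step_0.
  by apply: Step_xx; rewrite inE.
- by rewrite (cls_brxxx wm x_comp); exact: Step_0.
- by apply: Step_S; exact: lieSpan_ad.
- by rewrite br0r; exact: Step_0.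
- by rewrite cls_brr; apply: Step_lin; [exact: IHy|exact: IHz].
Qed.

(** The Jacobi identity for [x, x, z] when [x] is odd. *)
Lemma br_xx z : gdeg w \in Gminus gamma ->
  cls_br (cls_br x x) z = 2%:R *: cls_br x (cls_br x z).
Proof.
move=> wm; have := cls_jacobi z x_comp x_comp.
rewrite (gamma_minus wm) scaleN1r => /eqP; rewrite -subr_eq opprK => /eqP <-.
by rewrite scaler_nat.
Qed.

Lemma step_ad2 m z : gdeg w \in Gminus gamma -> step_span m z ->
  (mdeg (w + w + m) <= N)%N -> step_span (w + w + m)%MM (cls_br (cls_br x x) z).
Proof.
move=> wm Sz mN; rewrite (br_xx _ wm) -addmA; apply: step_spanZ.
apply: step_ad; last by rewrite addmA.
by apply: step_ad => //; apply: leq_trans mN; rewrite !mdegD leq_add2r leq_addr.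
Qed.

(** Up to weight [N], [step_span] is closed under the bracket. *)
Lemma step_br m n y z : step_span m y -> step_span n z -> (mdeg (m + n) <= N)%N ->
  step_span (m + n)%MM (cls_br y z).
Proof.
move=> Sy Sz; elim: Sy => {m y} [|wm|m y Sy|m|m a y y' _ IHy _ IHy'] mN.
- exact: step_ad.
- exact: step_ad2.
- have hy := lieSpan_comp elim_gens_homog Sy.
  elim: Sz mN => {n z} [|wm|n z Sz|n|n a z z' _ IHz _ IHz'] mN.
  + rewrite (cls_skew hy x_comp) -scaleNr addmC; apply: step_spanZ.
    by apply: step_ad; [exact: Step_S|rewrite addmC].
  + rewrite (cls_skew hy (cls_br_comp x_comp x_comp)) -scaleNr addmC; apply: step_spanZ.
    by apply: step_ad2 => //; [exact: Step_S|rewrite addmC].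
  + by apply: Step_S; apply: LieBr.
  + by rewrite br0r; exact: Step_0.
  + by rewrite cls_brr; apply: Step_lin; [exact: IHz|exact: IHz'].
- by rewrite br0l; exact: Step_0.
- by rewrite cls_brl; apply: Step_lin; [exact: IHy|exact: IHy'].
Qed.

(** Lazard elimination, spanning half. *)
Lemma lieSpan_step T m z :
  (forall n y, (n, y) \in T -> (n, y) = (w, x) \/ (n, y) \in S) ->
  lieSpan T m z -> (mdeg m <= N)%N -> step_span m z.
Proof.
move=> TS; elim=> {m z} [m z /TS[[-> ->]|Sz]|m n y z _ IHy _ IHz|m|m a y z _ IHy _ IHz] mN.
- exact: Step_x.
- apply: Step_S; apply: LieGen; apply/(elim_gensP _ _ _ _ _ w_gt0).
  by exists m, z, 0%N; rewrite mulm0n addm0.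
- apply: step_br => //; [apply: IHy|apply: IHz]; apply: leq_trans mN; rewrite mdegD.
    exact: leq_addr.
  exact: leq_addl.
- exact: Step_0.
- by apply: Step_lin; [exact: IHy|exact: IHz].
Qed.

Lemma elim_gens_sub T m z : (w, x) \in T -> {subset S <= T} ->
  lieSpan S' m z -> lieSpan T m z.
Proof.
move=> Tx ST; elim=> {m z} [m z Sz|m n y z _ Ty _ Tz|m|m a y z _ Ty _ Tz].
- case/(elim_gensP _ _ _ _ _ w_gt0): Sz => v [y [i [Sy -> -> _]]].
  elim: i => [|i IHi]; first by rewrite mulm0n addm0; apply: LieGen; exact: ST.
  by rewrite mulmS addmCA; apply: LieBr IHi; exact: LieGen.
- exact: LieBr.
- exact: Lie0.
- exact: LieLin.
Qed.

End Step.

End Elimination.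

(** * Matrices under the color commutator *)

Section MatrixColorAlgebra.

Variables (F : fieldType) (gT : finGroupType) (gamma : gT -> gT -> F).
Hypotheses (abG : abelian [set: gT]) (bichar : color_bicharacter gamma).
Variables (n : nat) (d : 'I_n -> gT).

Local Notation Mn := 'M[F]_n.
Implicit Types (A B C : Mn).

(** The [G]-degree of the matrix unit in position [(i, j)] when the [i]-th basis vector
    has degree [d i]. *)
Definition entry_deg i j : gT := (d i * (d j)^-1)%g.

Definition mx_comp (h : gT) A : Prop := forall i j, A i j != 0 -> entry_deg i j = h.

(** The color commutator, given entrywise so that it is bilinear by construction; on
    homogeneous [A], [B] of degrees [h], [h'] it is [AB - gamma(h, h') BA]
    ([mx_br_comp]). *)
Definition mx_br A B : Mn := \matrix_(i, k) \sum_j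
  (A i j * B j k - gamma (entry_deg j k) (entry_deg i j) * (B i j * A j k)).

(** The automorphism that multiplies the part of degree [h'] by [gamma(h, h')].  For
    [A] of degree [h] and any [B], the color commutator is [AB - twist h B A]
    ([mx_br_comp1]), which makes the Jacobi identity a computation. *)
Definition twist (h : gT) A : Mn := \matrix_(i, j) (gamma h (entry_deg i j) * A i j).

Lemma entry_degM i j k : (entry_deg i j * entry_deg j k = entry_deg i k)%g.
Proof. by rewrite /entry_deg mulgA mulgKV. Qed.

Lemma twistM h A B : twist h (A *m B) = twist h A *m twist h B.
Proof.
apply/matrixP=> i k; rewrite !mxE mulr_sumr; apply: eq_bigr => j _.
by rewrite !mxE -(entry_degM i j k) (bicharMr bichar) mulrACA.
Qed.

Lemma twistD h A B : twist h (A + B) = twist h A + twist h B.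
Proof. by apply/matrixP=> i j; rewrite !mxE mulrDr. Qed.

Lemma twistN h A : twist h (- A) = - twist h A.
Proof. by apply/matrixP=> i j; rewrite !mxE mulrN. Qed.

Lemma twist_twist h h' A : twist h (twist h' A) = twist (h * h')%g A.
Proof. by apply/matrixP=> i j; rewrite !mxE (bicharMl bichar) mulrA. Qed.

Lemma twist_comp h h' A : mx_comp h' A -> twist h A = gamma h h' *: A.
Proof.
move=> hA; apply/matrixP=> i j; rewrite !mxE.
by have [->|/hA <-//] := eqVneq (A i j) 0; rewrite !mulr0.
Qed.

Lemma mx_br_comp1 h A B : mx_comp h A -> mx_br A B = A *m B - twist h B *m A.
Proof.
move=> hA; apply/matrixP=> i k; rewrite !mxE -sumrB; apply: eq_bigr => j _.
rewrite !mxE mulrA; congr (_ - _).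
by have [->|/hA <-//] := eqVneq (A j k) 0; rewrite !mulr0.
Qed.

Lemma mx_br_comp h h' A B : mx_comp h A -> mx_comp h' B ->
  mx_br A B = A *m B - gamma h h' *: (B *m A).
Proof. by move=> hA hB; rewrite (mx_br_comp1 _ hA) (twist_comp _ hB) scalemxAl. Qed.

Lemma mx_comp_subspace h : is_subspace (mx_comp h).
Proof.
split=> [i j|a A B hA hB i j]; first by rewrite mxE eqxx.
rewrite !mxE; have [-> |/hA//] := eqVneq (A i j) 0.
by rewrite mulr0 add0r => /hB.
Qed.

Lemma mx_compM h h' A B : mx_comp h A -> mx_comp h' B -> mx_comp (h * h')%g (A *m B).
Proof.
move=> hA hB i k; rewrite mxE => /eqP nz.
have [j ABj] : exists j, A i j * B j k != 0.
  apply/existsP; apply: contra_notT nz; rewrite negb_exists => /forallP H.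
  by apply: big1 => j _; apply/eqP; have := H j; rewrite negbK.
move: ABj; rewrite mulf_eq0 negb_or => /andP[/hA <- /hB <-].
by rewrite entry_degM.
Qed.

Lemma mx_compL h a A B : mx_comp h A -> mx_comp h B -> mx_comp h (a *: A + B).
Proof. by case: (mx_comp_subspace h) => _; apply. Qed.

Lemma mx_grading : is_grading mx_comp.
Proof.
split=> [|A]; first exact: mx_comp_subspace.
exists [ffun h => \matrix_(i, j) (if entry_deg i j == h then A i j else 0)].
split=> [|c [hc ->]].
  split=> [h i j|].
    by rewrite ffunE mxE; case: (entry_deg i j =P h) => // _; rewrite eqxx.
  apply/matrixP=> i j; rewrite summxE (big_only1 (entry_deg i j)) //.
    by rewrite ffunE mxE eqxx.
  by move=> h neq _; rewrite ffunE mxE eq_sym (negPf neq).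
apply/ffunP=> h; rewrite ffunE; apply/matrixP=> i j; rewrite mxE summxE.
case: eqP => [<-|neq]; last by apply/esym/eqP; apply: contra_notT neq => /hc.
apply: big_only1 => // h' /eqP neq _.
by apply/eqP; apply: contra_notT neq => /hc.
Qed.

Lemma mx_brl a A B C : mx_br (a *: A + B) C = a *: mx_br A C + mx_br B C.
Proof.
apply/matrixP=> i k; rewrite !mxE mulr_sumr -big_split /=; apply: eq_bigr => j _.
by rewrite !mxE; ring.
Qed.

Lemma mx_brr a A B C : mx_br C (a *: A + B) = a *: mx_br C A + mx_br C B.
Proof.
apply/matrixP=> i k; rewrite !mxE mulr_sumr -big_split /=; apply: eq_bigr => j _.
by rewrite !mxE; ring.
Qed.

Lemma mx_br_in h h' A B : mx_comp h A -> mx_comp h' B -> mx_comp (h * h')%g (mx_br A B).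
Proof.
move=> hA hB; rewrite (mx_br_comp hA hB) -scaleNr addrC.
apply: mx_compL; last exact: mx_compM.
by rewrite (mulgC_ab abG); exact: mx_compM.
Qed.

Lemma mx_skew h h' A B : mx_comp h A -> mx_comp h' B ->
  mx_br A B = - (gamma h h' *: mx_br B A).
Proof.
move=> hA hB; rewrite (mx_br_comp hA hB) (mx_br_comp hB hA) scalerBr scalerA.
by rewrite (bichar_skew bichar) scale1r opprB.
Qed.

Lemma mx_jacobi h h' A B C : mx_comp h A -> mx_comp h' B ->
  mx_br A (mx_br B C) = mx_br (mx_br A B) C + gamma h h' *: mx_br B (mx_br A C).
Proof.
move=> hA hB.
rewrite (mx_br_comp1 _ hA) (mx_br_comp1 C hB) (mx_br_comp1 _ (mx_br_in hA hB)).
rewrite (mx_br_comp1 (mx_br A C) hB) (mx_br_comp1 C hA) (mx_br_comp hA hB).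
rewrite !(twistD, twistN) !twistM !twist_twist (twist_comp _ hA) (twist_comp _ hB).
rewrite (mulgC_ab abG h' h) !(mulmxBl, mulmxBr) -!(scalemxAl, scalemxAr).
rewrite !scalerBr !scalerA (bichar_skew bichar) scale1r !mulmxA.
move: (A *m B *m C) (A *m _ *m B) (_ *: (B *m _ *m A)) (_ *: (_ *m B *m A))
  (_ *m A *m B) (_ *: (B *m A *m C)) => t1 t2 t3 t4 t5 t6.
by apply/matrixP=> i k; rewrite !mxE; ring.
Qed.

Lemma mx_brxx h A : h \in Gplus gamma -> mx_comp h A -> mx_br A A = 0.
Proof.
by rewrite inE => /eqP hp hA; rewrite (mx_br_comp hA hA) hp scale1r subrr.
Qed.

Lemma mx_br_minus h A : h \in Gminus gamma -> mx_comp h A ->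
  mx_br A A = 2%:R *: (A *m A).
Proof.
move=> hm hA; rewrite (mx_br_comp hA hA) (gamma_minus bichar hm).
by rewrite scaleN1r opprK scaler_nat.
Qed.

Lemma mx_brxxx h A : h \in Gminus gamma -> mx_comp h A -> mx_br A (mx_br A A) = 0.
Proof.
move=> hm hA; rewrite (mx_br_minus hm hA) (mx_br_comp1 _ hA).
have -> : twist h (2%:R *: (A *m A)) = 2%:R *: (A *m A).
  rewrite !scaler_nat !mulr2n twistD twistM (twist_comp h hA) (gamma_minus bichar hm).
  by rewrite scaleN1r mulmxN mulNmx opprK.
by rewrite -scalemxAl -scalemxAr mulmxA subrr.
Qed.

(** Matrices under the color commutator form a color Lie superalgebra. *)
Definition mxColor : colorLieSuper gamma :=
  @ColorLieSuper F gT gamma 'M[F]_n mx_comp mx_br mx_grading mx_brl mx_brr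
    mx_br_in mx_skew mx_jacobi mx_brxx mx_brxxx.

End MatrixColorAlgebra.

(** * Iterated elimination *)

Section AssociativeElimination.

Variables (F : fieldType) (gT : finGroupType) (gamma : gT -> gT -> F).
Hypotheses (abG : abelian [set: gT]) (bichar : color_bicharacter gamma).
Variables (r : nat) (g : 'I_r -> gT) (L : colorLieSuper gamma).
Local Notation weight := 'X_{1..r}.
Local Notation gdeg := (gdeg g).
Implicit Types (m k w : weight) (x y z : L) (S T E : seq (weight * L)).

Definition positive S := forall m x, (m, x) \in S -> (0 < mdeg m)%N.

Definition bounded N S := forall m x, (m, x) \in S -> (mdeg m <= N)%N.

(** [elimination N T E]: the elements of [E], in this order, are the generators removed
    when one starts from the generators [T] and eliminates one generator after the
    other until none is left, with the truncation at [N] built into [elim_gens]. *)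
Inductive elimination N : seq (weight * L) -> seq (weight * L) -> Prop :=
| Elim_nil : elimination N [::] [::]
| Elim_cons w x S T E : perm_eq T ((w, x) :: S) ->
    elimination N (elim_gens N w x S) E -> elimination N T ((w, x) :: E).

Lemma elim_gens_positive N w x S : (0 < mdeg w)%N -> positive S ->
  positive (elim_gens N w x S).
Proof.
move=> w0 pS m z /(elim_gensP _ _ _ _ _ w0)[v [y [i [/pS v0 -> _ _]]]].
by rewrite mdegD ltn_addr.
Qed.

Lemma elim_gens_bounded N w x S : bounded N (elim_gens N w x S).
Proof. by move=> m z; rewrite mem_filter => /andP[]. Qed.

(** If [e] is a lower bound for the total weights of [x] and [S], eliminating [x] creates
    no further generator of total weight [e]. *)
Lemma elim_gens_count N w x S e : (0 < mdeg w)%N -> (e <= mdeg w)%N ->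
  (forall m y, (m, y) \in S -> e <= mdeg m)%N ->
  (count (fun p => mdeg p.1 == e) (elim_gens N w x S)
    <= count (fun p => mdeg p.1 == e) S)%N.
Proof.
move=> w0 ew; rewrite /elim_gens count_filter.
elim: S => [//|[m y] S IHS] geS; rewrite allpairs_cons count_cat count_map.
apply: leq_add; last by apply: IHS => m' y' S'; apply: (geS m' y'); rewrite inE S' orbT.
set P := preim _ _.
have -> : count P (iota 0 N.+1) = P 0%N.
  rewrite -[LHS]/(P 0 + count P (iota 1 N))%N; apply/eqP.
  rewrite -[eqbRHS]addn0 eqn_add2l eqn0Ngt -has_count; apply/hasPn => i.
  rewrite mem_iota => /andP[i0 _]; rewrite /P /= negb_and gtn_eqF // mdegD mdegMn.
  have := geS m y (mem_head _ _); have : (0 < mdeg w * i)%N by rewrite muln_gt0 w0.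
  by move=> h /leq_ltn_trans->//; rewrite -[X in (X < _)%N]addn0 ltn_add2l.
by rewrite /P /= mulm0n addm0; case: (mdeg m == e); rewrite ?andbF // leq_b1.
Qed.

(** Always eliminating a generator of the least total weight [e] terminates: the number
    of generators of total weight [e] decreases, and once it is zero [e] increases. *)
Lemma elimination_exists N T : positive T -> bounded N T ->
  exists E, elimination N T E.
Proof.
move=> pT bT.
have [e [ge_e eN]] : exists e,
    (forall m y, (m, y) \in T -> e <= mdeg m)%N /\ (0 < e <= N.+1)%N.
  by exists 1%N; split=> // m y /pT.
elim: {eN}(N.+1 - e)%N {-2}e (erefl (N.+1 - e)%N) eN T pT bT ge_e
    => {e} [|u IHu] e eu eN T pT bT ge_e.
  case: T pT bT ge_e => [|[m y] T] pT bT ge_e; first by exists [::]; constructor.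
  move/eqP: eu; rewrite subn_eq0 => /leq_trans/(_ (ge_e m y (mem_head _ _))).
  by rewrite ltnNge (bT m y (mem_head _ _)).
have [c] := ubnP (count (fun p => mdeg p.1 == e) T).
elim: c T pT bT ge_e => // c IHc T pT bT ge_e cT.
have [/hasP[[w x] Tx /= /eqP we]|noe] := boolP (has (fun p => mdeg p.1 == e) T).
  have pe := perm_to_rem Tx; set S := rem (w, x) T in pe.
  have ST : {subset S <= T} by move=> p; exact: mem_rem.
  have w0 : (0 < mdeg w)%N by exact: pT Tx.
  have [||||E elE] := IHc (elim_gens N w x S).
  - by apply: elim_gens_positive => // m y /ST; exact: pT.
  - exact: elim_gens_bounded.
  - move=> m z /(elim_gensP _ _ _ _ _ w0)[v [y [i [/ST/ge_e ev -> _ _]]]].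
    by rewrite mdegD; apply: leq_trans ev (leq_addr _ _).
  - rewrite (seq.permP pe) /= we eqxx add1n ltnS in cT; apply: leq_ltn_trans cT.
    by apply: elim_gens_count => // [|m y /ST]; [rewrite we|exact: ge_e].
  by exists ((w, x) :: E); apply: Elim_cons pe elE.
apply: (IHu e.+1) => //.
- by rewrite subnS eu.
- by have : (0 < N.+1 - e)%N by [rewrite eu]; rewrite subn_gt0.
- move=> m y Ty; rewrite ltn_neqAle (ge_e m y Ty) andbT eq_sym.
  by apply: contraNneq noe => me; apply/hasP; exists (m, y); rewrite //= me.
Qed.

Lemma wspan_mono (V : lmodType F) (S1 S2 : seq (weight * V)) m v :
  {subset S1 <= S2} -> wspan S1 m v -> wspan S2 m v.
Proof.
move=> S12; elim=> {m v} [m v /S12 ?|m|m a u v _ Su _ Sv].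
- exact: WspanGen.
- exact: Wspan0.
- exact: WspanLin.
Qed.

(** The candidate basis read off an elimination: the eliminated elements [x], together
    with the squares [[x,x]] of the odd ones. *)
Definition lie_gens E : seq (weight * L) :=
  E ++ [seq ((p.1 + p.1)%MM, cls_br p.2 p.2) | p <- E & gdeg p.1 \in Gminus gamma].

Lemma lie_gens_cons p E : {subset lie_gens E <= lie_gens (p :: E)}.
Proof.
move=> q; rewrite !mem_cat => /orP[Eq|Eq]; first by rewrite inE Eq orbT.
by apply/orP; right; rewrite /=; case: ifP => _ //; apply/predU1P; right.
Qed.

Lemma elimination_good N T E : elimination N T E -> homogeneous g T -> positive T ->
  bounded N T -> forall w x, (w, x) \in E ->
  [/\ (0 < mdeg w)%N, (mdeg w <= N)%N, cls_comp (gdeg w) x & lieSpan T w x].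
Proof.
elim=> {T E} // w x S T E pe elE IH hT pT bT v y.
have Tx : (w, x) \in T by rewrite (perm_mem pe) mem_head.
have ST : {subset S <= T} by move=> p Sp; rewrite (perm_mem pe) inE Sp orbT.
have w0 : (0 < mdeg w)%N by exact: pT Tx.
rewrite inE => /predU1P[[-> ->]|Ey].
  by split=> //; [exact: bT Tx|exact: hT|exact: LieGen].
have [|||v0 vN cy Sy] := IH _ _ _ v y Ey.
- by apply: elim_gens_homog (hT _ _ Tx) _ => // m z /ST; exact: hT.
- by apply: elim_gens_positive => // m z /ST; exact: pT.
- exact: elim_gens_bounded.
by split=> //; apply: elim_gens_sub Sy.
Qed.

Lemma lieSpan_nil m z : lieSpan [::] m z -> z = 0 :> L.
Proof.
by elim=> {m z} [//|m n y z _ -> _ _|//|m a y z _ -> _ ->]; rewrite ?br0l ?scaler0 ?addr0.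
Qed.

Lemma elimination_lieSpan N T E : elimination N T E -> homogeneous g T -> positive T ->
  forall m z, lieSpan T m z -> (mdeg m <= N)%N -> wspan (lie_gens E) m z.
Proof.
elim=> {T E} [_ _|w x S T E pe elE IH hT pT] m z Tz mN.
  by rewrite (lieSpan_nil Tz); exact: Wspan0.
have Tx : (w, x) \in T by rewrite (perm_mem pe) mem_head.
have ST : {subset S <= T} by move=> p Sp; rewrite (perm_mem pe) inE Sp orbT.
have w0 : (0 < mdeg w)%N by exact: pT Tx.
have hS : homogeneous g S by move=> v y /ST; exact: hT.
have pS : positive S by move=> v y /ST; exact: pT.
have xw := hT _ _ Tx.
have TS v y : (v, y) \in T -> (v, y) = (w, x) \/ (v, y) \in S.
  by rewrite (perm_mem pe) inE => /predU1P.
have Exx : (w, x) \in lie_gens ((w, x) :: E) by rewrite mem_head.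
elim: (lieSpan_step abG bichar w0 xw hS TS Tz mN) (mN)
  => {m z Tz mN} [|wm|m z Sz|m|m a y z _ IHy _ IHz] mN.
- exact: WspanGen.
- apply: WspanGen; rewrite mem_cat; apply/orP; right.
  by apply/mapP; exists (w, x); rewrite //= wm mem_head.
- apply: (wspan_mono (@lie_gens_cons _ _)); apply: IH Sz mN.
    exact: elim_gens_homog.
  exact: elim_gens_positive.
- exact: Wspan0.
- by apply: WspanLin; [exact: IHy|exact: IHz].
Qed.

End AssociativeElimination.

(** * Elimination in an associative algebra *)

Section AssociativeSpan.

Variables (F : fieldType) (gT : finGroupType) (gamma : gT -> gT -> F).
Hypotheses (abG : abelian [set: gT]) (bichar : color_bicharacter gamma).
Variables (r : nat) (g : 'I_r -> gT) (L : colorLieSuper gamma).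
Variables (n : nat) (f : {linear L -> 'M[F]_n}).
Hypothesis f_br : forall h h' x y, cls_comp h x -> cls_comp h' y ->
  f (cls_br x y) = f x *m f y - gamma h h' *: (f y *m f x).

Local Notation weight := 'X_{1..r}.
Local Notation gdeg := (gdeg g).
Implicit Types (m k w : weight) (x y z : L) (S T E : seq (weight * L)).
Implicit Types (A B : 'M[F]_n).

(** Weight [m] part of the unital associative algebra generated by the matrices [f x],
    for [x] in the list [S]. *)
Inductive algSpan S : weight -> 'M[F]_n -> Prop :=
| Alg1 : algSpan S 0%MM 1%:M
| AlgMul m k x A : (m, x) \in S -> algSpan S k A -> algSpan S (m + k)%MM (f x *m A)
| Alg0 m : algSpan S m 0
| AlgLin m a A B : algSpan S m A -> algSpan S m B -> algSpan S m (a *: A + B).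

Definition mxpow A (j : nat) : 'M[F]_n := iter j (mulmx A) 1%:M.

Lemma mxpowS A j : mxpow A j.+1 = A *m mxpow A j. Proof. by []. Qed.

(** The monomials [f(x_l)^(j_l) ... f(x_1)^(j_1)] with all exponents below [K], where
    [x_1, ..., x_l] is the list of eliminated elements. *)
Fixpoint ordered_monomials (K : nat) E : seq (weight * 'M[F]_n) :=
  if E is (w, x) :: E' then
    [seq ((p.1 + w *+ j)%MM, p.2 *m mxpow (f x) j) |
       j <- iota 0 K, p <- ordered_monomials K E']
  else [:: (0%MM, 1%:M)].

Section Step.

Variables (N : nat) (w : weight) (x : L) (S : seq (weight * L)).
Hypotheses (w_gt0 : (0 < mdeg w)%N) (x_comp : cls_comp (gdeg w) x).
Hypothesis S_homog : homogeneous g S.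

Local Notation S' := (elim_gens N w x S).

(** The color commutator with [f x] preserves the algebra generated by the images of
    the new generators. *)
Lemma algSpan_ad m A : algSpan S' m A -> (mdeg (w + m) <= N)%N ->
  algSpan S' (w + m)%MM (f x *m A - gamma (gdeg w) (gdeg m) *: (A *m f x)).
Proof.
elim=> {m A} [|m k y A Sy SA IH|m|m a A B _ IHA _ IHB] mN.
- rewrite gdeg0 (gamma1r bichar) scale1r mulmx1 mul1mx subrr; exact: Alg0.
- have Sxy : (w + m, cls_br x y)%MM \in S'.
    case/(elim_gensP _ _ _ _ _ w_gt0): (Sy) => v [z [i [Sz em ez _]]].
    apply/(elim_gensP _ _ _ _ _ w_gt0); exists v, z, i.+1.
    split=> //; rewrite ?ez // ?em ?mulmS 1?addmCA //.
    by rewrite addmCA -em; apply: leq_trans mN; rewrite !mdegD addnA leq_addr.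
  have hy := elim_gens_homog abG w_gt0 x_comp S_homog Sy.
  have kN : (mdeg (w + k) <= N)%N.
    by apply: leq_trans mN; rewrite !mdegD leq_add2l leq_addl.
  have h1 := AlgMul Sxy SA; rewrite -addmA in h1.
  have h2 := AlgMul Sy (IH kN); rewrite addmCA in h2.
  have := AlgLin (gamma (gdeg w) (gdeg m)) h2 h1; congr algSpan.
  rewrite (f_br x_comp hy) (gdegD abG) (bicharMr bichar).
  rewrite mulmxBr mulmxBl -!(scalemxAl, scalemxAr) scalerBr scalerA !mulmxA.
  by rewrite addrC addrA subrK.
- by rewrite mulmx0 mul0mx scaler0 subrr; exact: Alg0.
- have := AlgLin a (IHA mN) (IHB mN); congr algSpan.
  rewrite mulmxDr mulmxDl -!(scalemxAl, scalemxAr) scalerBr scalerDr !scalerA.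
  by rewrite opprD addrACA mulrC.
Qed.

(** The sum over [j] of the spaces [B (f x)^j], where [B] is the algebra generated by
    the images of the new generators. *)
Inductive powSpan : weight -> 'M[F]_n -> Prop :=
| Pow_gen m A j : algSpan S' m A -> powSpan (m + w *+ j)%MM (A *m mxpow (f x) j)
| Pow_0 m : powSpan m 0
| Pow_lin m a A B : powSpan m A -> powSpan m B -> powSpan m (a *: A + B).

(** Because [x a x^j = [x,a] x^j + c a x^(j+1)] with a scalar [c]. *)
Lemma powSpan_x m A : powSpan m A -> (mdeg (w + m) <= N)%N ->
  powSpan (w + m)%MM (f x *m A).
Proof.
elim=> {m A} [m A j SA|m|m a A B _ IHA _ IHB] mN.
- have wmN : (mdeg (w + m) <= N)%N.
    by apply: leq_trans mN; rewrite !mdegD addnA leq_addr.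
  have h1 := Pow_gen j (algSpan_ad SA wmN).
  have h2 := Pow_gen j.+1 SA; rewrite mulmS addmCA addmA in h2.
  have := Pow_lin (gamma (gdeg w) (gdeg m)) h2 h1; rewrite addmA; congr powSpan.
  by rewrite mulmxBl -scalemxAl mxpowS !mulmxA addrC subrK.
- by rewrite mulmx0; exact: Pow_0.
- by rewrite mulmxDr -scalemxAr; apply: Pow_lin; [exact: IHA|exact: IHB].
Qed.

Lemma powSpan_mul m k y A : (k, y) \in S' -> powSpan m A ->
  powSpan (k + m)%MM (f y *m A).
Proof.
move=> Sy; elim=> {m A} [m A j SA|m|m a A B _ IHA _ IHB].
- by rewrite addmA mulmxA; apply: Pow_gen; exact: AlgMul.
- by rewrite mulmx0; exact: Pow_0.
- by rewrite mulmxDr -scalemxAr; apply: Pow_lin.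
Qed.

Lemma algSpan_step T m A :
  (forall k y, (k, y) \in T -> (k, y) = (w, x) \/ (k, y) \in S) ->
  algSpan T m A -> (mdeg m <= N)%N -> powSpan m A.
Proof.
move=> TS; elim=> {m A} [|m k y A Ty SA IH|m|m a A B _ IHA _ IHB] mN.
- by have := Pow_gen 0 (Alg1 S'); rewrite mulm0n addm0 mulmx1.
- have kN : (mdeg k <= N)%N by apply: leq_trans mN; rewrite mdegD leq_addl.
  case: (TS _ _ Ty) => [[em ey]|Sy].
    by rewrite em ey in mN *; apply: powSpan_x => //; exact: IH.
  apply: powSpan_mul (IH kN); apply/(elim_gensP _ _ _ _ _ w_gt0).
  exists m, y, 0%N; rewrite mulm0n addm0; split=> //.
  by apply: leq_trans mN; rewrite mdegD leq_addr.
- exact: Pow_0.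
- by apply: Pow_lin; [exact: IHA|exact: IHB].
Qed.

End Step.

Lemma algSpan_nil m A : algSpan [::] m A -> wspan [:: (0%MM, 1%:M)] m A.
Proof.
elim=> {m A} [|//|m|m a A B _ IHA _ IHB].
- by apply: WspanGen; rewrite mem_head.
- exact: Wspan0.
- exact: WspanLin.
Qed.

Lemma wspan_pow K w x E m A j : (j < K)%N ->
  wspan (ordered_monomials K E) m A ->
  wspan (ordered_monomials K ((w, x) :: E)) (m + w *+ j)%MM (A *m mxpow (f x) j).
Proof.
move=> jK; elim=> {m A} [m A EA|m|m a A B _ IHA _ IHB].
- apply: WspanGen; apply/allpairsP; exists (j, (m, A)); split=> //.
  by rewrite mem_iota.
- by rewrite mul0mx; exact: Wspan0.
- by rewrite mulmxDl -scalemxAl; exact: WspanLin.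
Qed.

(** Ordered monomials in the eliminated elements span; an exponent larger than [N] never
    occurs in weights up to [N]. *)
Lemma elimination_algSpan N K T E : (N < K)%N ->
  elimination N T E -> homogeneous g T -> positive T ->
  forall m A, algSpan T m A -> (mdeg m <= N)%N -> wspan (ordered_monomials K E) m A.
Proof.
move=> NK; elim=> {T E} [_ _|w x S T E pe elE IH hT pT] m A TA mN.
  exact: algSpan_nil.
have Tx : (w, x) \in T by rewrite (perm_mem pe) mem_head.
have ST : {subset S <= T} by move=> p Sp; rewrite (perm_mem pe) inE Sp orbT.
have w0 : (0 < mdeg w)%N by exact: pT Tx.
have hS : homogeneous g S by move=> v y /ST; exact: hT.
have pS : positive S by move=> v y /ST; exact: pT.
have xw := hT _ _ Tx.
have TS v y : (v, y) \in T -> (v, y) = (w, x) \/ (v, y) \in S.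
  by rewrite (perm_mem pe) inE => /predU1P.
elim: (algSpan_step w0 xw hS TS TA mN) (mN)
  => {m A TA mN} [m A j SA|m|m a A B _ IHA _ IHB] mN.
- apply: wspan_pow.
    apply: leq_ltn_trans NK; apply: leq_trans mN; rewrite mdegD mdegMn.
    by rewrite (leq_trans _ (leq_addl _ _)) // leq_pmull.
  apply: IH SA _.
  + exact: (elim_gens_homog abG).
  + exact: elim_gens_positive.
  + by apply: leq_trans mN; rewrite mdegD leq_addr.
- exact: Wspan0.
- by apply: WspanLin; [exact: IHA|exact: IHB].
Qed.

(** Among the ordered monomials are the images of the eliminated elements and the squares
    of these images, at pairwise different places of the list. *)
Lemma ordered_monomials_squares K E : (2 < K)%N -> exists Z,
  perm_eq (ordered_monomials K E)
    ([seq (p.1, f p.2) | p <- E] ++ [seq ((p.1 + p.1)%MM, f p.2 *m f p.2) | p <- E] ++ Z).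
Proof.
case: K => [|[|[|K]]] // _.
(* The empty monomial is carried along in the induction, as multiplying it by
   [f x] and [(f x)^2] produces the two new entries. *)
suff [Z pZ] : exists Z, perm_eq (ordered_monomials K.+3 E)
    ((0%MM, 1%:M) ::
     [seq (p.1, f p.2) | p <- E] ++ [seq ((p.1 + p.1)%MM, f p.2 *m f p.2) | p <- E] ++ Z).
  exists ((0%MM, 1%:M) :: Z); apply: perm_trans pZ _.
  by rewrite perm_sym !catA -cat1s perm_catCA cat1s.
elim: E => [|[w x] E [Z IH]]; first by exists [::].
set l1 := [seq (p.1, f p.2) | p <- E] in IH.
set l2 := [seq ((p.1 + p.1)%MM, f p.2 *m f p.2) | p <- E] in IH.
set O := ordered_monomials K.+3 E in IH.
pose h j (p : weight * 'M[F]_n) := ((p.1 + w *+ j)%MM, p.2 *m mxpow (f x) j).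
have -> : ordered_monomials K.+3 ((w, x) :: E) =
    map (h 0%N) O ++ map (h 1%N) O ++ map (h 2%N) O ++ [seq h j p | j <- iota 3 K, p <- O].
  by [].
have h0 : map (h 0%N) O = O.
  by rewrite -[RHS]map_id; apply: eq_map => -[m A]; rewrite /h mulm0n addm0 mulmx1.
have h1 : h 1%N (0%MM, 1%:M) = (w, f x).
  by rewrite /h add0m mulm1n mul1mx mxpowS mulmx1.
have h2 : h 2%N (0%MM, 1%:M) = ((w + w)%MM, f x *m f x).
  by rewrite /h add0m mul1mx !mxpowS mulmx1 mulmS mulm1n.
move: (map (h 0%N) O) h0 => _ ->.
have p1 : perm_eq (map (h 1%N) O) ((w, f x) :: map (h 1%N) (l1 ++ l2 ++ Z)).
  by rewrite -h1 -map_cons; apply: perm_map.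
have p2 : perm_eq (map (h 2%N) O) (((w + w)%MM, f x *m f x) :: map (h 2%N) (l1 ++ l2 ++ Z)).
  by rewrite -h2 -map_cons; apply: perm_map.
move: (map (h 1%N) O) (map (h 2%N) O) p1 p2 => O1 O2 p1 p2.
exists (Z ++ map (h 1%N) (l1 ++ l2 ++ Z) ++ map (h 2%N) (l1 ++ l2 ++ Z)
          ++ [seq h j p | j <- iota 3 K, p <- O]).
apply: perm_trans (perm_cat IH (perm_cat p1 (perm_cat p2 (perm_refl _)))) _.
rewrite -/l1 -/l2 /=.
apply/seq.permP => P; rewrite /= !(count_cat, map_cat) /= !count_cat /= !count_cat.
by rewrite -/l1 -/l2; ring.
Qed.

End AssociativeSpan.

(** * Generating functions modulo high degree *)

Section Counting.

Variables (r N : nat).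
Local Notation weight := 'X_{1..r}.
Local Notation poly := {mpoly rat[r]}.
Implicit Types (m w : weight) (p q : poly) (ws : seq weight).

(** Congruence of polynomials modulo terms of total degree above [N]. *)
Definition eqN p q : Prop := forall m, (mdeg m <= N)%N -> p@_m = q@_m.

Local Notation "p =~ q" := (eqN p q) (at level 70).

Lemma eqN_refl p : p =~ p. Proof. by []. Qed.

Lemma eqN_sym p q : p =~ q -> q =~ p.
Proof. by move=> pq m mN; rewrite pq. Qed.

Lemma eqN_trans p q s : p =~ q -> q =~ s -> p =~ s.
Proof. by move=> pq qs m mN; rewrite pq // qs. Qed.

Lemma eqND p1 q1 p2 q2 : p1 =~ q1 -> p2 =~ q2 -> p1 + p2 =~ q1 + q2.
Proof. by move=> h1 h2 m mN; rewrite !mcoeffD h1 // h2. Qed.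

Lemma eqNN p q : p =~ q -> - p =~ - q.
Proof. by move=> h m mN; rewrite !mcoeffN h. Qed.

Lemma eqNB p1 q1 p2 q2 : p1 =~ q1 -> p2 =~ q2 -> p1 - p2 =~ q1 - q2.
Proof. by move=> h1 h2; apply: eqND => //; exact: eqNN. Qed.

Lemma eqNM p1 q1 p2 q2 : p1 =~ q1 -> p2 =~ q2 -> p1 * p2 =~ q1 * q2.
Proof.
move=> h1 h2 m mN; rewrite !mcoeffM; apply: eq_bigr => k _.
by rewrite h1 ?h2 //; apply: leq_trans mN; rewrite -ltnS bmdeg.
Qed.

Lemma eqN_sum (I : Type) (s : seq I) (f g : I -> poly) :
  (forall i, f i =~ g i) -> \sum_(i <- s) f i =~ \sum_(i <- s) g i.
Proof.
by move=> h; elim: s => [|i s IH]; rewrite ?big_nil // !big_cons; apply: eqND.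
Qed.

Lemma eqN_high m : (N < mdeg m)%N -> 'X_[m] =~ (0 : poly).
Proof.
move=> Nm m' m'N; rewrite mcoeffX mcoeff0; case: eqP => // e.
by move: m'N; rewrite -e leqNgt Nm.
Qed.

(** Generating function of a list of weights. *)
Definition genfun ws : poly := \sum_(w <- ws) 'X_[w].

Definition factors ws : poly := \prod_(w <- ws) (1 - 'X_[w]).

Definition geometric w (K : nat) : poly := \sum_(i <- iota 0 K) 'X_[w *+ i].

Lemma geometricE w K : (1 - 'X_[w]) * geometric w K = 1 - 'X_[w *+ K].
Proof.
rewrite /geometric -{1}[K]subn0 -/(index_iota 0 K) big_mkord -mpolyXn.
rewrite -[1 - _ ^+ _]opprB subrX1 -mulNr opprB; congr (_ * _).
by apply: eq_bigr => i _; rewrite mpolyXn.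
Qed.

Lemma geometric_inv w K : (0 < mdeg w)%N -> (N < K)%N ->
  (1 - 'X_[w]) * geometric w K =~ 1.
Proof.
move=> w0 NK; rewrite geometricE -[X in eqN _ X]subr0; apply: eqNB => //.
apply: eqN_high; rewrite mdegMn; apply: leq_trans NK _.
by rewrite leq_pmull.
Qed.

(** Replacing [x] and [S] by the [ad(x)^i y] turns [t^w + P] into [P / (1 - t^w)], where
    [P] is the generating function of [S]. *)
Lemma genfun_elim (F : fieldType) (gT : finGroupType) (gamma : gT -> gT -> F)
    (L : colorLieSuper gamma) w (x : L) (S : seq (weight * L)) : (0 < mdeg w)%N ->
  1 - genfun (unzip1 ((w, x) :: S)) =~
    (1 - 'X_[w]) * (1 - genfun (unzip1 (elim_gens N w x S))).
Proof.
move=> w0.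
have h : genfun (unzip1 (elim_gens N w x S))
    =~ genfun (unzip1 (S)) * geometric w N.+1.
  rewrite /genfun !big_map big_filter big_mkcond big_allpairs_dep mulr_suml.
  apply: eqN_sum => -[m y]; rewrite mulr_sumr; apply: eqN_sum => i.
  rewrite -mpolyXD /=; case: leqP => // mN.
  by apply: eqN_sym; exact: eqN_high.
apply: eqN_sym; apply: eqN_trans (eqNM (eqN_refl _) (eqNB (eqN_refl _) h)) _.
rewrite mulrBr mulr1 mulrCA /genfun /= big_cons opprD addrA; apply: eqNB => //.
by rewrite -[X in eqN _ X]mulr1; apply: eqNM => //; exact: geometric_inv.
Qed.

Lemma elimination_genfun (F : fieldType) (gT : finGroupType) (gamma : gT -> gT -> F)
    (L : colorLieSuper gamma) (T E : seq (weight * L)) :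
  elimination N T E -> positive T ->
  1 - genfun (unzip1 (T)) =~ factors (unzip1 (E)).
Proof.
elim=> {T E} [_|w x S T E pe elE IH pT].
  by rewrite /genfun /factors !big_nil subr0.
have Tx : (w, x) \in T by rewrite (perm_mem pe) mem_head.
have ST : {subset S <= T} by move=> p Sp; rewrite (perm_mem pe) inE Sp orbT.
have w0 : (0 < mdeg w)%N by exact: pT Tx.
have -> : genfun (unzip1 (T)) = genfun (unzip1 ((w, x) :: S)).
  by apply: perm_big; exact: perm_map.
rewrite /factors /= big_cons; apply: eqN_trans (genfun_elim _ _ w0) _.
apply: eqNM => //; apply: IH; apply: elim_gens_positive => // m y /ST; exact: pT.
Qed.

(** The Euler derivation, which multiplies a term by its total degree. *)
Definition euler p : poly := \sum_(i < r) 'X_i * p^`M(i).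

Lemma eulerB p q : euler (p - q) = euler p - euler q.
Proof. by rewrite -sumrB; apply: eq_bigr => i _; rewrite mderivB mulrBr. Qed.

Lemma eulerM p q : euler (p * q) = euler p * q + p * euler q.
Proof.
rewrite /euler mulr_suml mulr_sumr -big_split /=; apply: eq_bigr => i _.
by rewrite mderivM; ring.
Qed.

Lemma euler_sum (I : Type) (s : seq I) (f : I -> poly) :
  euler (\sum_(i <- s) f i) = \sum_(i <- s) euler (f i).
Proof.
rewrite /euler exchange_big /=; apply: eq_bigr => i _.
by rewrite raddf_sum mulr_sumr.
Qed.

Lemma eulerZ c p : euler (c *: p) = c *: euler p.
Proof. by rewrite scaler_sumr; apply: eq_bigr => i _; rewrite mderivZ scalerAr. Qed.

Lemma eulerX m : euler 'X_[m] = (mdeg m)%:R *: 'X_[m].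
Proof.
rewrite mdegE natr_sum scaler_suml; apply: eq_bigr => i _.
rewrite mderivX -scalerAr -mpolyXD.
have [->|mi] := posnP (m i); first by rewrite !scale0r.
by rewrite addmC submK //; apply/mnm_lepP => j; rewrite mnm1E; case: eqP => // <-.
Qed.

Lemma euler1 : euler 1 = 0.
Proof. by rewrite -mpolyX0 eulerX mdeg0 scale0r. Qed.

Lemma mcoeff_euler p m : (euler p)@_m = (mdeg m)%:R * p@_m.
Proof.
have [c ec] : {c : rat | c = (mdeg m)%:R} by exists (mdeg m)%:R.
rewrite -ec [p]mpolyE euler_sum !raddf_sum mulr_sumr /=.
apply: eq_bigr => k _; rewrite eulerZ eulerX !mcoeffZ mcoeffX.
by case: eqP => [->|_]; [rewrite !mulr1 mulrC ec|rewrite !mulr0].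
Qed.

Lemma eqN_euler p q : p =~ q -> euler p =~ euler q.
Proof. by move=> h m mN; rewrite !mcoeff_euler h. Qed.

(** Minus the logarithmic Euler derivative of [factors ws], truncated:
    the sum of [|w| t^w / (1 - t^w)]. *)
Definition logder ws : poly :=
  \sum_(w <- ws) (mdeg w)%:R *: ('X_[w] * geometric w N).

Lemma euler_factors ws : (forall w, w \in ws -> (0 < mdeg w)%N) ->
  euler (factors ws) =~ - (logder ws * factors ws).
Proof.
rewrite /factors /logder; elim: ws => [|w ws IH] pos.
  by rewrite !big_nil euler1 mul0r oppr0.
rewrite !big_cons eulerM eulerB euler1 eulerX sub0r.
set H := \sum_(_ <- _) _ in IH *; set P := \prod_(_ <- _) _ in IH *.
rewrite [(_ + H) * _]mulrDl opprD; apply: eqND; last first.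
  rewrite mulrCA -mulrN; apply: eqNM => //; apply: IH => v wsv.
  by apply: pos; rewrite inE wsv orbT.
rewrite mulNr; apply: eqNN; rewrite mulrA; apply: eqNM => //.
rewrite -scalerAl -!mul_mpolyC; apply: eqNM => //.
rewrite -mulrA [geometric w N * _]mulrC geometricE mulrBr mulr1 -mpolyXD -mulmS.
rewrite -[X in eqN X _]subr0; apply: eqNB => //; apply: eqN_sym; apply: eqN_high.
by rewrite mdegMn leq_pmull // pos ?mem_head.
Qed.

(** The number of words of multidegree [m] when there are [s i] letters of weight the
    [i]-th unit vector. *)
Definition word_count (s : 'I_r -> nat) m : rat :=
  ((mdeg m)`!)%:R / (\prod_(i < r) ((m i)`!)%:R) * \prod_(i < r) (s i)%:R ^+ m i.

Lemma word_count0 s : word_count s 0%MM = 1.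
Proof.
rewrite /word_count mdeg0 fact0 !big1 ?divr1 ?mulr1 // => i _.
  by rewrite mnm0E expr0.
by rewrite mnm0E fact0.
Qed.

(** Deleting the first letter of a word, in the closed form of [word_count]. *)
Lemma word_countU s i m :
  (mdeg m).+1%:R * ((s i)%:R * word_count s m) =
  (m i).+1%:R * word_count s (U_(i) + m)%MM.
Proof.
rewrite /word_count mdegD mdeg1 add1n factS natrM.
rewrite (bigD1 i) //= [\prod_(j < r) (s j)%:R ^+ m j](bigD1 i) //=.
rewrite [\prod_(j < r) ((U_(i) + m)%MM j)`!%:R](bigD1 i) //=.
rewrite [\prod_(j < r) _ ^+ (U_(i) + m)%MM j](bigD1 i) //=.
rewrite mnmDE mnm1E eqxx add1n factS natrM exprS.
have e j : j != i -> (U_(i) + m)%MM j = m j.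
  by move=> ji; rewrite mnmDE mnm1E eq_sym (negPf ji).
rewrite [\prod_(j < r | _) ((_ + _)%MM j)`!%:R](eq_bigr (fun j => ((m j)`!)%:R));
  last by move=> j ji; rewrite e.
rewrite [\prod_(j < r | _) _ ^+ (_ + _)%MM j](eq_bigr (fun j => (s j)%:R ^+ m j));
  last by move=> j ji; rewrite e.
set Q := \prod_(j < r | _) _%:R; have Q0 : Q != 0.
  by apply/prodf_neq0 => j _; rewrite pnatr_eq0 -lt0n fact_gt0.
have f0 : ((m i)`!)%:R != 0 :> rat by rewrite pnatr_eq0 -lt0n fact_gt0.
have m0 : (m i).+1%:R != 0 :> rat by rewrite pnatr_eq0.
by field; rewrite Q0 f0 nat1r m0.
Qed.

Definition linear_form (s : 'I_r -> nat) : poly := \sum_(i < r) (s i)%:R *: 'X_i.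

Lemma mcoeff_XM i m p :
  ('X_i * p)@_m = if (0 < m i)%N then p@_(m - U_(i)) else 0.
Proof.
case: ltnP => [mi|].
  rewrite -{1}(@submK _ U_(i) m); last first.
    by apply/mnm_lepP => j; rewrite mnm1E; case: eqP => // <-.
  by rewrite mulrC addmC mcoeffMX.
rewrite leqn0 => /eqP mi; rewrite [p]mpolyE mulr_sumr raddf_sum /= big1 // => k _.
rewrite -scalerAr -mpolyXD mcoeffZ mcoeffX; case: eqP => [e|]; rewrite ?mulr0 //.
by move: mi; rewrite -e mnmDE mnm1E eqxx.
Qed.

Lemma mcoeff_linear_form s p m :
  (linear_form s * p)@_m =
    \sum_(i < r) (s i)%:R * (if (0 < m i)%N then p@_(m - U_(i)) else 0).
Proof.
rewrite /linear_form mulr_suml raddf_sum; apply: eq_bigr => i _ /=.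
by rewrite -scalerAl mcoeffZ mcoeff_XM.
Qed.

Lemma eqN_word_count s p : p =~ 1 + linear_form s * p ->
  forall m, (mdeg m <= N)%N -> p@_m = word_count s m.
Proof.
move=> hp m; have [c] := ubnP (mdeg m); elim: c m => // c IH m mc mN.
rewrite hp // mcoeffD mcoeff1 mcoeff_linear_form.
have [->|m0] := eqVneq m 0%MM.
  by rewrite big1 ?addr0 ?word_count0 // => i _; rewrite mnm0E mulr0.
rewrite add0r.
have md0 : (mdeg m)%:R != 0 :> rat by rewrite pnatr_eq0 mdeg_eq0.
apply: (mulfI md0); rewrite mulr_sumr {2}mdegE natr_sum mulr_suml.
apply: eq_bigr => i _; case: posnP => [->|mi]; first by rewrite !mulr0 mul0r.
have em : m = (U_(i) + (m - U_(i)))%MM.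
  by rewrite addmC submK //; apply/mnm_lepP => j; rewrite mnm1E; case: eqP => // <-.
move: (m - U_(i))%MM em => k em; rewrite em mdegD mdeg1 add1n ltnS in mc mN.
rewrite IH //; last exact: ltnW.
by rewrite em mdegD mdeg1 add1n word_countU mnmDE mnm1E eqxx.
Qed.

Lemma mcoeff_logder ws m : (forall w, w \in ws -> (0 < mdeg w)%N) ->
  (logder ws)@_m = \sum_(w <- ws) \sum_(1 <= j < N.+1)
     (if (w *+ j)%MM == m then (mdeg w)%:R else 0).
Proof.
move=> pos; rewrite /logder raddf_sum; apply: eq_bigr => w _ /=.
rewrite mcoeffZ /geometric; move: (mdeg w)%:R => c.
rewrite mulr_sumr raddf_sum mulr_sumr /=.
rewrite big_add1 /= /index_iota subn0; apply: eq_bigr => j _.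
by rewrite -mpolyXD -mulmS mcoeffX; case: eqP; rewrite ?mulr1 ?mulr0.
Qed.

(** If [P] is a linear form and [H] stands for [logder ws], then applying the Euler
    derivation to [1 - P = factors ws] gives [P = H (1 - P)], that is
    [1 + H = 1 + P (1 + H)], which is the recursion of [word_count]. *)
Lemma logder_word_count s ws : (forall w, w \in ws -> (0 < mdeg w)%N) ->
  1 - linear_form s =~ factors ws ->
  forall m, (mdeg m <= N)%N -> m != 0%MM -> (logder ws)@_m = word_count s m.
Proof.
move=> pos hf m mN m0.
have hP : euler (linear_form s) = linear_form s.
  by rewrite euler_sum; apply: eq_bigr => i _; rewrite eulerZ eulerX mdeg1 scale1r.
have h : - linear_form s =~ - (logder ws * (1 - linear_form s)).
  rewrite -{1}hP -[- euler _]add0r -euler1 -eulerB.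
  apply: eqN_trans (eqN_euler hf) _; apply: eqN_trans (euler_factors pos) _.
  by apply: eqNN; apply: eqNM => //; exact: eqN_sym.
have h1 : 1 + logder ws =~ 1 + linear_form s * (1 + logder ws).
  apply: eqND => //; apply: eqN_sym.
  apply: (@eqN_trans _ (logder ws * (1 - linear_form s) + linear_form s * logder ws)).
    rewrite mulrDr mulr1; apply: eqND => //.
    by have := eqNN h; rewrite !opprK.
  by rewrite mulrBr mulr1 [logder ws * _]mulrC subrK.
by rewrite -(eqN_word_count h1 mN) mcoeffD mcoeff1 (negPf m0) add0r.
Qed.

(** A list of weights whose generating function is inverse to [1 - P], for [P] the linear
    form of the letters, has as many entries of total weight at most [N] as there are
    words of length at most [N]. *)
Lemma count_monomials s ws (O : seq weight) :
  (forall w, w \in ws -> (0 < mdeg w)%N) -> 1 - linear_form s =~ factors ws ->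
  genfun O * factors ws =~ 1 ->
  size [seq m <- O | mdeg m <= N]%N = (\sum_(k < N.+1) (\sum_(i < r) s i) ^ k)%N.
Proof.
move=> pos hf hO.
set O' := [seq m <- O | _].
have hO' : genfun O' =~ genfun O.
  rewrite /genfun big_filter big_mkcond; apply: eqN_sum => m.
  by case: leqP => // mN; apply: eqN_sym; exact: eqN_high.
pose Q := \sum_(k < N.+1) linear_form s ^+ k.
have PN k : linear_form s ^+ k \is k.-homog.
  rewrite -[k in k.-homog]mul1n; apply: dhomogMn; apply: rpred_sum => i _.
  by apply: rpredZ; rewrite dhomogX /= mdeg1.
have P0 k m : mdeg m != k -> (linear_form s ^+ k)@_m = 0.
  by move=> mk; apply: dhomog_nemf_coeff (PN k) mk.
have hQ : (1 - linear_form s) * Q =~ 1.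
  rewrite /Q -[1 - _]opprB mulNr -subrX1 opprB -[X in eqN _ X]subr0; apply: eqNB => //.
  by move=> m mN; rewrite mcoeff0 P0 // neq_ltn ltnS mN.
have eQ : genfun O' =~ Q.
  apply: eqN_trans hO' _; rewrite -[genfun O]mulr1.
  apply: eqN_trans (eqNM (eqN_refl _) (eqN_sym hQ)) _.
  rewrite mulrA -[X in eqN _ X]mul1r; apply: eqNM => //.
  by apply: eqN_trans hO; apply: eqNM.
have {}eQ : genfun O' = Q.
  apply/mpolyP => m; have [mN|Nm] := leqP (mdeg m) N; first exact: eQ.
  have -> : Q@_m = 0.
    rewrite /Q raddf_sum /= big1 // => k _; apply: P0.
    by rewrite gtn_eqF // (leq_trans (ltn_ord k)).
  rewrite /genfun raddf_sum /= big_filter big1 // => k kN; rewrite mcoeffX.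
  by case: eqP => // e; move: kN; rewrite e leqNgt Nm.
have := congr1 (meval (fun=> 1)) eQ.
rewrite /genfun /Q !raddf_sum /=.
rewrite (eq_bigr (fun=> 1)) => [|m _]; last by rewrite mevalX big1 // => i _; rewrite expr1n.
rewrite big_const_seq count_predT iter_addr_0 => e; apply/eqP.
rewrite -(eqr_nat rat) e natr_sum; apply/eqP; apply: eq_bigr => k _.
rewrite rmorphXn /= natrX; congr (_ ^+ _); rewrite /linear_form raddf_sum natr_sum.
by apply: eq_bigr => i _; rewrite /= mevalZ mevalXU mulr1.
Qed.

End Counting.

(** * Moebius inversion *)

Section Moebius.

Lemma moebius_mulp (p d : nat) : prime p -> (0 < d)%N ->
  moebius (p * d) = if (p %| d)%N then 0 else - moebius d.
Proof.
move=> pp d0; have p0 := prime_gt0 pp; have pd0 : (0 < p * d)%N by rewrite muln_gt0 p0.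
rewrite /moebius pd0 d0 /=; case: (boolP (p %| d)%N) => [pd|pNd].
  have pin : p \in primes (p * d) by rewrite mem_primes pp pd0 dvdn_mulr.
  case: ifP => // /allP/(_ _ pin); rewrite lognM // logn_prime // eqxx add1n eqSS.
  by rewrite eqn0Ngt logn_gt0 mem_primes pp d0 pd.
have pe : perm_eq (primes (p * d)) (p :: primes d).
  apply: uniq_perm; rewrite ?primes_uniq //= ?primes_uniq ?andbT.
    by rewrite mem_primes pp d0.
  by move=> q; rewrite primesM // primes_prime // !inE.
rewrite (perm_all _ pe) (perm_size pe) /= lognM // logn_prime // eqxx.
rewrite (_ : logn p d = 0)%N /=; last first.
  by apply/eqP; rewrite eqn0Ngt logn_gt0 mem_primes pp d0.
rewrite (@eq_in_all _ _ (fun q => logn q d == 1%N)).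
  by case: ifP; rewrite ?oppr0 // exprS mulN1r.
move=> q; rewrite mem_primes => /and3P[pq _ qd].
rewrite lognM // logn_prime //; case: (q =P p) => // e.
by rewrite -e qd in pNd.
Qed.

Lemma mem_divisors (n d : nat) : (0 < n)%N -> (d \in divisors n) = (d %| n)%N.
Proof. by move=> n0; rewrite dvdn_divisors. Qed.

Lemma sum_divisors_mul (R : nmodType) (n D : nat) (f : nat -> R) :
  (0 < D)%N -> (n %| D)%N ->
  \sum_(d <- divisors (D %/ n)) f (n * d)%N = \sum_(e <- divisors D | (n %| e)%N) f e.
Proof.
move=> D0 nD; have n0 := dvdn_gt0 D0 nD.
rewrite -[RHS]big_filter -(big_map (muln n) xpredT f); apply: perm_big; apply: uniq_perm.
- by rewrite map_inj_uniq ?divisors_uniq // => x y /eqP; rewrite eqn_pmul2l // => /eqP.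
- by rewrite filter_uniq ?divisors_uniq.
have Dn0 : (0 < D %/ n)%N by rewrite divn_gt0 // dvdn_leq.
move=> e; rewrite mem_filter mem_divisors //; apply/mapP/andP.
  case=> d; rewrite mem_divisors // => dD ->; rewrite dvdn_mulr //.
  by rewrite -(divnK nD) mulnC dvdn_pmul2r.
case=> /dvdnP[d ->]; rewrite mulnC => dD; exists d => //.
by rewrite mem_divisors // -(dvdn_pmul2l n0) [(n * (D %/ n))%N]mulnC divnK.
Qed.

(** For [n > 1] and [p] a prime factor of [n], the divisors [p d] with [p] not
    dividing [d] cancel the divisors prime to [p]. *)
Lemma moebius_sum (n : nat) : (0 < n)%N ->
  \sum_(d <- divisors n) moebius d = (n == 1%N)%:R.
Proof.
move=> n0; have [->|n1] := eqVneq n 1%N; first by rewrite big_seq1.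
have pp : prime (pdiv n) by apply: pdiv_prime; case: n n0 n1 => [|[]].
have pn := pdiv_dvd n; move: (pdiv n) pp pn => p pp pn.
have p0 := prime_gt0 pp; have np0 : (0 < n %/ p)%N by rewrite divn_gt0 // dvdn_leq.
rewrite (bigID (fun d => p %| d)%N) /= -sum_divisors_mul //.
rewrite [X in X + _](_ : _ = - \sum_(d <- divisors (n %/ p) | ~~ (p %| d)%N) moebius d).
  rewrite -[X in _ + X]big_filter -[X in - X]big_filter addrC; apply/eqP.
  rewrite subr_eq0; apply/eqP; apply: perm_big; apply: uniq_perm.
  - by rewrite filter_uniq ?divisors_uniq.
  - by rewrite filter_uniq ?divisors_uniq.
  move=> d; rewrite !mem_filter !mem_divisors //; case: (boolP (p %| d)%N) => //= pd.
  rewrite -{1}(divnK pn) Gauss_dvdl // coprime_sym prime_coprime //.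
rewrite -sumrN [RHS]big_mkcond big_seq [RHS]big_seq; apply: eq_bigr => d.
rewrite mem_divisors // => /(dvdn_gt0 np0) d0; rewrite moebius_mulp //.
by case: (p %| d)%N; rewrite ?oppr0.
Qed.

Lemma moebius_inversion (D : nat) (f : nat -> rat) : (0 < D)%N ->
  \sum_(n <- divisors D) (moebius n)%:~R * (\sum_(d <- divisors (D %/ n)) f (n * d)%N)
    = f 1%N.
Proof.
move=> D0.
rewrite (eq_big_seq (fun n => \sum_(e <- divisors D)
    (if (n %| e)%N then (moebius n)%:~R * f e else 0))); last first.
  by move=> n; rewrite mem_divisors // => nD; rewrite sum_divisors_mul // mulr_sumr
    big_mkcond.
rewrite exchange_big /=.
rewrite (eq_big_seq (fun e => (e == 1%N)%:R * f e)); last first.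
  move=> e; rewrite mem_divisors // => eD; have e0 := dvdn_gt0 D0 eD.
  rewrite -big_mkcond -big_filter -mulr_suml; congr (_ * _).
  have -> : (e == 1%N)%:R = ((e == 1%N)%:R : int)%:~R :> rat by case: eqP.
  rewrite -moebius_sum // rmorph_sum; apply: perm_big; apply: uniq_perm.
  - by rewrite filter_uniq ?divisors_uniq.
  - exact: divisors_uniq.
  move=> n; rewrite mem_filter !mem_divisors //.
  by case: (boolP (n %| e)%N) => //= /dvdn_trans->.
rewrite (bigD1_seq 1%N) ?divisors_uniq ?mem_divisors ?dvd1n //= mul1r.
by rewrite big1 ?addr0 // => e /negPf->; rewrite mul0r.
Qed.

(** Effect of the signs in the Witt formula.  For odd [a] they all cancel.  For even [a]
    only the [n] with [a / n] odd contribute a correction; such an [n] is some [2 m], and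
    [moebius (2 m)] is [- moebius m] for [m] odd and 0 otherwise, so that the correction
    is twice the unsigned sum over the divisors of [D / 2], present exactly when [D] is
    even and [a / 2] is odd. *)
Lemma signed_moebius_sum (D a : nat) (V : nat -> rat) : (0 < D)%N -> (D %| a)%N ->
  (-1) ^+ a * (\sum_(n <- divisors D) (moebius n)%:~R * ((-1) ^+ (a %/ n) * V n))
  = \sum_(n <- divisors D) (moebius n)%:~R * V n +
    (if (2 %| D)%N && odd (a %/ 2)
     then 2%:R * \sum_(m <- divisors (D %/ 2)) (moebius m)%:~R * V (2 * m)%N else 0).
Proof.
move=> D0 Da; have [oa|ea] := boolP (odd a).
  have /negPf-> : ~~ (2 %| D)%N.
    by apply: contraL oa => /dvdn_trans/(_ Da); rewrite dvdn2.
  rewrite addr0 -signr_odd oa expr1 mulN1r -sumrN; apply: eq_big_seq => n.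
  rewrite mem_divisors // => /dvdn_trans/(_ Da) na.
  have := oa; rewrite -{1}(divnK na) oddM => /andP[on _].
  by rewrite -(signr_odd _ (a %/ n)) on expr1 mulN1r mulrN opprK.
rewrite -signr_odd (negPf ea) expr0 mul1r.
pose o n : rat := (odd (a %/ n))%:R.
have -> : \sum_(n <- divisors D) (moebius n)%:~R * ((-1) ^+ (a %/ n) * V n) =
   \sum_(n <- divisors D) (moebius n)%:~R * V n
   + (- 2%:R) * \sum_(n <- divisors D) o n * ((moebius n)%:~R * V n).
  rewrite mulr_sumr -big_split /=; apply: eq_bigr => n _.
  by rewrite -signr_odd /o; case: (odd _); rewrite ?expr1 ?expr0 /=; ring.
congr (_ + _).
have odd2 n : (n %| D)%N -> ~~ (2 %| n)%N -> o n = 0.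
  move=> nD; rewrite dvdn2 negbK /o => on.
  move: ea; rewrite -{1}(divnK (dvdn_trans nD Da)) oddM on andbT.
  by move/negPf->.
case: (boolP (2 %| D)%N) => [D2|ND2] /=; last first.
  rewrite big1_seq ?mulr0 // => n; rewrite mem_divisors // => /= nD.
  by rewrite odd2 ?mul0r //; apply: contra ND2 => /dvdn_trans; apply.
rewrite (bigID (fun n => 2 %| n)%N) /= -[X in _ * (X + _)]sum_divisors_mul //.
rewrite [X in _ * (_ + X)]big1_seq ?addr0; last first.
  by move=> n; rewrite mem_divisors // => /andP[n2 nD]; rewrite odd2 ?mul0r.
have D20 : (0 < D %/ 2)%N by rewrite divn_gt0 // dvdn_leq.
have Da2 : (D %/ 2 %| a %/ 2)%N by rewrite -(@dvdn_pmul2r 2) // !divnK // (dvdn_trans D2).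
have oE m : o (2 * m)%N = (odd (a %/ 2 %/ m))%:R by rewrite /o divnMA.
case: ifP => oa2; last first.
  rewrite big1_seq ?mulr0 // => m; rewrite mem_divisors // => /= mD.
  rewrite oE moebius_mulp //; last exact: dvdn_gt0 mD.
  case: ifPn => m2; first by rewrite mul0r mulr0.
  move: oa2; rewrite -{1}(divnK (dvdn_trans mD Da2)) oddM.
  by move: m2; rewrite dvdn2 negbK => ->; rewrite andbT => ->; rewrite mul0r.
rewrite mulNr -mulrN -sumrN; congr (_ * _); apply: eq_big_seq => m.
rewrite mem_divisors // => mD; rewrite oE moebius_mulp //; last exact: dvdn_gt0 mD.
have := oa2; rewrite -{1}(divnK (dvdn_trans mD Da2)) oddM => /andP[-> om].
by rewrite dvdn2 om /= rmorphN /= mulNr mulrN mul1r opprK.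
Qed.

End Moebius.

(** * Matrices acting on words *)

Section WordMatrices.

Variables (F : fieldType) (gT : finGroupType) (X : finType) (deg : X -> gT) (N : nat).

Local Notation n := #|{: N.-bseq X}|.

(** The matrices are indexed by the words of length at most [N], graded by the product
    of the degrees of the letters. *)
Definition word_deg (i : 'I_n) : gT := (\prod_(x <- val (enum_val i)) deg x)%g.

(** Left multiplication by the letter [x] on the words of length at most [N], longer
    words being set to zero. *)
Definition lmul (x : X) : 'M[F]_n :=
  \matrix_(i, j) (val (enum_val i) == x :: val (enum_val j))%:R.

(** The basis vector of the word [s], or 0 if [s] is longer than [N]. *)
Definition word_vec (s : seq X) : 'cV[F]_n := \col_i (val (enum_val i) == s)%:R.

Lemma lmul_comp x : mx_comp word_deg (deg x) (lmul x).
Proof.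
move=> i j; rewrite mxE; case: (val (enum_val i) =P _) => [e _|_]; last by rewrite eqxx.
by rewrite /entry_deg /word_deg e big_cons mulgK.
Qed.

Lemma lmul_word x (s : seq X) : (size s < N)%N -> lmul x *m word_vec s = word_vec (x :: s).
Proof.
move=> sN; have sN' : (size s <= N)%N := ltnW sN.
apply/matrixP=> i j; rewrite !mxE.
have ej : val (enum_val (enum_rank (Bseq sN'))) = s by rewrite enum_rankK.
rewrite (big_only1 (enum_rank (Bseq sN'))) //; first by rewrite !mxE ej eqxx mulr1.
move=> k neq _; rewrite !mxE; case: (_ =P s) => [e|]; rewrite ?mulr0 //.
by case/eqP: neq; apply: enum_val_inj; apply: val_inj; rewrite /= ej.
Qed.

Lemma word_vec_span (v : 'cV[F]_n) : v = \sum_i v i 0 *: word_vec (val (enum_val i)).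
Proof.
apply/matrixP=> i j; rewrite ord1 summxE (big_only1 i) //; first by rewrite !mxE eqxx mulr1.
move=> k ki _; rewrite !mxE; case: eqP => [/val_inj/enum_val_inj e|]; rewrite ?mulr0 //.
by rewrite e eqxx in ki.
Qed.

End WordMatrices.

Lemma wspan_coords (F : fieldType) (r : nat) (V : lmodType F) (S : seq ('X_{1..r} * V)) m v :
  wspan S m v ->
  exists c : 'I_(size [seq p.2 | p <- S & p.1 == m]) -> F,
    v = \sum_i c i *: [seq p.2 | p <- S & p.1 == m]`_i.
Proof.
elim=> {m v} [m v Sv|m|m a u v _ [cu ->] _ [cv ->]].
- set l := [seq p.2 | p <- S & p.1 == m].
  have lv : v \in l by apply/mapP; exists (m, v); rewrite // mem_filter eqxx.
  have iv : (index v l < size l)%N by rewrite index_mem.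
  exists (fun i => (i == Ordinal iv)%:R).
  rewrite (big_only1 (Ordinal iv)) //= ?eqxx ?scale1r ?nth_index //.
  by move=> j /negPf-> _; rewrite scale0r.
- by exists (fun=> 0); rewrite big1 // => i _; rewrite scale0r.
- exists (fun i => a * cu i + cv i); rewrite scaler_sumr -big_split /=.
  by apply: eq_bigr => i _; rewrite scalerDl scalerA.
Qed.

(** Freeness is inherited when the first part of a family is filtered further. *)
Lemma free_sub_filter (F : fieldType) (V : vectType F) (I : eqType) (a b : pred I)
    (h : I -> V) (l : seq I) (Z : seq V) :
  (forall i, b i -> a i) -> free ([seq h i | i <- l & a i] ++ Z) ->
  free ([seq h i | i <- l & b i] ++ Z).
Proof.
move=> ba; set A := map h _; set B := map h _.
have e : filter b l = filter b (filter a l).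
  by rewrite -filter_predI; apply: eq_filter => i /=; case: (boolP (b i)) => // /ba ->.
rewrite (@perm_free _ _ _ ((B ++ [seq h i | i <- filter (predC b) (filter a l)]) ++ Z)).
  rewrite -catA (@perm_free _ _ _ ([seq h i | i <- filter (predC b) (filter a l)] ++ (B ++ Z))).
    exact: catr_free.
  by rewrite perm_catCA.
rewrite perm_cat2r /A /B e -map_cat; apply: perm_map.
by rewrite perm_sym; apply: permEl; exact: perm_filterC.
Qed.

(** A family is independent if a linear map sends it to nonzero multiples of a free
    family. *)
Lemma scaled_independent (F : fieldType) (V : lmodType F) (W : vectType F)
    (h : {linear V -> W}) (l : seq V) (u : seq W) (t : nat -> F) d :
  size u = d -> free u -> (forall i, (i < d)%N -> t i != 0) ->
  (forall i, (i < d)%N -> h l`_i = t i *: u`_i) ->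
  forall c : 'I_d -> F, \sum_i c i *: l`_i = 0 -> forall i, c i = 0.
Proof.
move=> <- fu t0 hl c c0 i.
have /freeP H : free (in_tuple u) by [].
have /H/(_ i)/eqP : \sum_(j < size u) (c j * t j) *: (in_tuple u)`_j = 0.
  rewrite -[RHS](linear0 h) -c0 linear_sum; apply: eq_bigr => j _.
  by rewrite linearZ /= hl // scalerA.
by rewrite mulf_eq0 (negPf (t0 _ (ltn_ord i))) orbF => /eqP.
Qed.

Section MonomialGenerating.

Variables (F : fieldType) (gT : finGroupType) (gamma : gT -> gT -> F).
Variables (r n : nat) (L : colorLieSuper gamma) (f : {linear L -> 'M[F]_n}).

Lemma ordered_monomials_genfun N K (E : seq ('X_{1..r} * L)) : (N < K)%N ->
  (forall w x, (w, x) \in E -> (0 < mdeg w)%N) ->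
  eqN N (genfun (unzip1 (ordered_monomials f K E)) * factors (unzip1 E)) 1.
Proof.
move=> NK; elim: E => [|[w x] E IH] pos.
  by rewrite /genfun /factors /= big_seq1 big_nil mulr1 mpolyX0.
have -> : genfun (unzip1 (ordered_monomials f K ((w, x) :: E))) =
    geometric w K * genfun (unzip1 (ordered_monomials f K E)).
  rewrite /genfun /geometric !big_map big_allpairs_dep mulr_suml.
  apply: eq_bigr => j _; rewrite mulr_sumr; apply: eq_bigr => p _.
  by rewrite -mpolyXD addmC.
rewrite /factors /= big_cons mulrACA [geometric w K * _]mulrC.
rewrite -[X in eqN _ _ X]mulr1; apply: eqNM.
  by apply: geometric_inv NK; apply: (pos w x); rewrite mem_head.
by apply: IH => v y Ey; apply: (pos v y); rewrite inE Ey orbT.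
Qed.

End MonomialGenerating.

(** * A basis of the free color Lie superalgebra *)

Section FreeBasis.

Variables (F : fieldType) (gT : finGroupType) (gamma : gT -> gT -> F).
Hypotheses (abG : abelian [set: gT]) (bichar : color_bicharacter gamma).
Variables (r : nat) (g : 'I_r -> gT) (ginv : gT -> 'I_r).
Hypotheses (gK : cancel g ginv) (ginvK : cancel ginv g).
Variables (X : finType) (deg : X -> gT) (s : 'I_r -> nat).
Hypothesis card_X : forall i : 'I_r, #|[set x : X | deg x == g i]| = s i.
Variables (L : colorLieSuper gamma) (iota : X -> L).

Local Notation weight := 'X_{1..r}.
Local Notation gdeg := (gdeg g).

Definition gen_weight (x : X) : weight := U_(ginv (deg x)).

(** The free generators with their weights. *)
Definition generators : seq (weight * L) := [seq (gen_weight x, iota x) | x <- index_enum X].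

Definition to_weight (alpha : {ffun 'I_r -> nat}) : weight := [multinom alpha i | i < r].

Lemma mem_generators x : (gen_weight x, iota x) \in generators.
Proof. by apply/mapP; exists x; rewrite ?mem_index_enum. Qed.

Lemma generators_positive : positive generators.
Proof. by move=> m z /mapP[x _ [-> _]]; rewrite mdeg1. Qed.

Lemma generators_bounded N : (0 < N)%N -> bounded N generators.
Proof. by move=> N0 m z /mapP[x _ [-> _]]; rewrite mdeg1. Qed.

Lemma generators_homog : degree_preserving deg iota -> homogeneous g generators.
Proof. by move=> hi m z /mapP[x _ [-> ->]]; rewrite gdegU ginvK. Qed.

Lemma multicomp_lieSpan alpha z :
  multicomp g deg iota alpha z -> lieSpan generators (to_weight alpha) z.
Proof.
elim=> {alpha z} [i x dx|alpha beta x y _ Sx _ Sy|alpha|alpha a x y _ Sx _ Sy].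
- have -> : to_weight [ffun j => (j == i : nat)] = gen_weight x.
    by apply/mnmP => j; rewrite mnmE ffunE mnm1E dx gK eq_sym.
  by apply: LieGen; exact: mem_generators.
- have -> : to_weight [ffun j => (alpha j + beta j)%N] = (to_weight alpha + to_weight beta)%MM.
    by apply/mnmP => j; rewrite mnmDE !mnmE ffunE.
  exact: LieBr.
- exact: Lie0.
- exact: LieLin.
Qed.

Lemma lieSpan_multicomp m z :
  lieSpan generators m z -> multicomp g deg iota [ffun i => m i] z.
Proof.
elim=> {m z} [m z /mapP[x _ [-> ->]]|m n y z _ Sy _ Sz|m|m a y z _ Sy _ Sz].
- have -> : [ffun i => gen_weight x i] = [ffun j => (j == ginv (deg x) : nat)].
    by apply/ffunP => j; rewrite !ffunE mnm1E eq_sym.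
  by apply: Multicomp_gen; rewrite ginvK.
- have -> : [ffun i => (m + n)%MM i]
      = [ffun j => ([ffun i => m i] j + [ffun i => n i] j)%N].
    by apply/ffunP => j; rewrite !ffunE mnmDE.
  exact: Multicomp_br.
- exact: Multicomp_0.
- exact: Multicomp_lin.
Qed.

Lemma to_weightK alpha : [ffun i => to_weight alpha i] = alpha.
Proof. by apply/ffunP => i; rewrite ffunE mnmE. Qed.

Lemma generators_genfun : genfun (unzip1 generators) = linear_form s.
Proof.
rewrite /genfun /linear_form /unzip1 /generators !big_map /=.
rewrite (partition_big (fun x => ginv (deg x)) xpredT) //=; apply: eq_bigr => i _.
rewrite (eq_bigr (fun=> 'X_i)) => [|x /eqP <-//].
rewrite sumr_const -scaler_nat -card_X; congr (_%:R *: _); apply: eq_card => x.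
by rewrite !inE -(can_eq ginvK) gK.
Qed.

Lemma sum_card_X : (\sum_(i < r) s i)%N = #|X|.
Proof.
rewrite -sum1_card (partition_big (fun x => ginv (deg x)) xpredT) //=.
apply: eq_bigr => i _; rewrite sum1_card -card_X; apply: eq_card => x.
by rewrite !inE -(can_eq ginvK) gK.
Qed.

Section Independence.

Variables (N : nat) (E : seq (weight * L)).
Hypotheses (N_gt0 : (0 < N)%N) (elimE : elimination N generators E).
Hypothesis gens_homog : homogeneous g generators.

Local Notation n := #|{: N.-bseq X}|.

Variable f : {linear L -> 'M[F]_n}.
Hypothesis f_br : forall h h' x y, cls_comp h x -> cls_comp h' y ->
  f (cls_br x y) = f x *m f y - gamma h h' *: (f y *m f x).
Hypothesis f_gen : forall x, f (iota x) = lmul F N x.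

Let mons := ordered_monomials f N.+3 E.
Let v0 : 'cV[F]_n := word_vec F N [::].

Lemma elim_positive w x : (w, x) \in E -> (0 < mdeg w)%N.
Proof.
by case/(elimination_good abG elimE gens_homog generators_positive (generators_bounded N_gt0)).
Qed.

Lemma elim_factors : eqN N (1 - linear_form s) (factors (unzip1 E)).
Proof.
rewrite -generators_genfun; apply: elimination_genfun elimE _.
exact: generators_positive.
Qed.

Lemma elim_unzip_positive w : w \in unzip1 E -> (0 < mdeg w)%N.
Proof. by case/mapP => -[v x] Ex -> /=; exact: elim_positive Ex. Qed.

Lemma word_alg (t : seq X) : (size t <= N)%N -> exists m A,
  [/\ algSpan f generators m A, mdeg m = size t & A *m v0 = word_vec F N t].
Proof.
elim: t => [|x t IH] tN.
  by exists 0%MM, 1%:M; rewrite mdeg0 mul1mx; split=> //; exact: Alg1.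
have [m [A [SA em eA]]] := IH (ltnW tN).
exists (gen_weight x + m)%MM, (f (iota x) *m A); split.
- by apply: AlgMul SA; exact: mem_generators.
- by rewrite mdegD mdeg1 em.
- by rewrite -mulmxA eA f_gen lmul_word.
Qed.

(** Applied to the empty word, the ordered monomials span the space of words of length
    at most [N]; as there are as many of them as words, they are independent. *)
Lemma monomials_free :
  free [seq q.2 *m v0 | q <- mons & (mdeg q.1 <= N)%N].
Proof.
set vs := map _ _.
have span_vs m A : wspan mons m A -> (mdeg m <= N)%N -> (A *m v0 \in <<vs>>)%VS.
  elim=> {m A} [m A mA|m|m a A B _ IHA _ IHB] mN.
  - by apply: memv_span; apply/mapP; exists (m, A); rewrite // mem_filter mN.
  - by rewrite mul0mx mem0v.
  - by rewrite mulmxDl -scalemxAl memvD ?memvZ ?IHA ?IHB.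
have vs_full : <<vs>>%VS = fullv.
  apply/eqP; rewrite eqEsubv subvf; apply/subvP => v _.
  rewrite [v]word_vec_span; apply: memv_suml => i _; apply: memvZ.
  have [m [A [SA em <-]]] := word_alg (size_bseq (enum_val i)).
  have mN : (mdeg m <= N)%N by rewrite em size_bseq.
  apply: span_vs (mN).
  apply: (elimination_algSpan abG bichar f_br _ elimE gens_homog generators_positive SA mN).
  by rewrite !ltnS -addn2 leq_addr.
rewrite /free vs_full dimvf dim_matrix mulr1 size_map size_filter.
apply/eqP; apply: etrans (card_bseq N X) _; rewrite -sum_card_X.
rewrite -(@count_monomials _ N s (unzip1 E) (unzip1 mons)).
- by rewrite size_filter count_map.
- exact: elim_unzip_positive.
- exact: elim_factors.
- by apply: ordered_monomials_genfun; [rewrite !ltnS -addn2 leq_addr|exact: elim_positive].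
Qed.

(** The images of the eliminated elements and of their squares are distinct ordered
    monomials, hence independent. *)
Lemma squares_free m : (mdeg m <= N)%N ->
  free ([seq f p.2 *m v0 | p <- E & p.1 == m] ++
        [seq f p.2 *m f p.2 *m v0 | p <- E
           & ((p.1 + p.1)%MM == m) && (gdeg p.1 \in Gminus gamma)]).
Proof.
move=> mN; have [Z pZ] := ordered_monomials_squares f E (isT : (2 < N.+3)%N).
have := monomials_free.
have /perm_free-> := perm_map (fun q => q.2 *m v0) (perm_filter (fun q => mdeg q.1 <= N)%N pZ).
rewrite !filter_cat !map_cat catA => /catl_free; rewrite !filter_map -!map_comp.
set b2 := fun p : weight * L => ((p.1 + p.1)%MM == m) && _.
move=> fAB; apply: (free_sub_filter (a := fun p => mdeg p.1 <= N)%N).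
  by move=> p /eqP->.
rewrite (perm_free (permEl (perm_catC _ _))).
apply: (free_sub_filter (a := fun p => mdeg (p.1 + p.1)%MM <= N)%N).
  by move=> p /andP[/eqP-> _].
by rewrite (perm_free (permEl (perm_catC _ _))).
Qed.

Lemma filter_lie_gens m : [seq q.2 | q <- lie_gens g E & q.1 == m] =
  [seq p.2 | p <- E & p.1 == m] ++ [seq cls_br p.2 p.2 | p <- E
     & ((p.1 + p.1)%MM == m) && (gdeg p.1 \in Gminus gamma)].
Proof.
by rewrite /lie_gens filter_cat map_cat filter_map -map_comp -filter_predI.
Qed.

Lemma lie_gens_independent m : (mdeg m <= N)%N ->
  forall c : 'I_(size [seq q.2 | q <- lie_gens g E & q.1 == m]) -> F,
    \sum_i c i *: [seq q.2 | q <- lie_gens g E & q.1 == m]`_i = 0 ->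
    forall i, c i = 0.
Proof.
move=> mN; have := squares_free mN; rewrite filter_lie_gens.
set E1 := [seq p <- E | p.1 == m].
set E2 := [seq p <- E | ((p.1 + p.1)%MM == m) && (gdeg p.1 \in Gminus gamma)].
set u1 := [seq f p.2 *m v0 | p <- E1]; set u2 := [seq _ *m v0 | p <- E2]; move=> fu.
(* For odd [x], [f] maps [[x,x]] to [2 (f x)^2], and 2 is invertible. *)
pose t (i : nat) : F := if (i < size E1)%N then 1 else 2%:R.
pose h : {linear L -> 'cV[F]_n} := (mulmxr v0 \o f : L -> 'cV[F]_n).
apply: (@scaled_independent _ _ _ h _ (u1 ++ u2) t) => // [|i|i].
- by rewrite !size_cat !size_map.
- rewrite size_cat !size_map /t => ilt; case: ltnP => [_|iE1]; first exact: oner_neq0.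
  have : (i - size E1 < size E2)%N by rewrite ltn_subLR.
  case eE : E2 => [//|p E2'] _; apply: (@Gminus_neq2 _ _ _ bichar (gdeg p.1)).
  have : p \in E2 by rewrite eE mem_head.
  by rewrite mem_filter => /andP[/andP[]].
- rewrite size_cat !size_map => ilt; rewrite !nth_cat !size_map /t.
  case: ltnP => iE1.
    have [p0 _] : exists p : weight * L, True by exists (0%MM, 0).
    by rewrite !(nth_map p0) // scale1r.
  have jlt : (i - size E1 < size E2)%N by rewrite ltn_subLR.
  rewrite !(nth_map (0%MM, 0)) //=.
  have := mem_nth (0%MM, 0) jlt; case: (nth _ E2 _) => w x /=.
  rewrite mem_filter => /andP[/= /andP[_ wm] Ex].
  have [_ _ xc _] :=
    elimination_good abG elimE gens_homog generators_positive (generators_bounded N_gt0) Ex.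
  rewrite (f_br xc xc) (gamma_minus bichar wm) scaleN1r opprK mulmxDl.
  by rewrite scaler_nat mulr2n.
Qed.

(** In weights up to [N], the elements of [lie_gens g E] form a basis. *)
Lemma multicomp_has_dim alpha : (mdeg (to_weight alpha) <= N)%N ->
  has_dim (multicomp g deg iota alpha)
    (count (fun q => q.1 == to_weight alpha) (lie_gens g E)).
Proof.
move=> mN; rewrite -size_filter -(size_map snd).
exists (fun i => [seq q.2 | q <- lie_gens g E & q.1 == to_weight alpha]`_i); split.
- move=> i; have := mem_nth 0 (ltn_ord i).
  set z := nth _ _ _; case/mapP => -[m y]; rewrite mem_filter /= => /andP[/eqP em Ey ->].
  rewrite -[alpha]to_weightK -em; apply: lieSpan_multicomp.
  have good := elimination_good abG elimE gens_homog generators_positive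
    (generators_bounded N_gt0).
  move: Ey; rewrite mem_cat => /orP[/good[]//|/mapP[[w x]]].
  rewrite mem_filter => /andP[_ /good[_ _ _ Sx]] [-> ->].
  exact: LieBr.
- exact: lie_gens_independent.
- move=> v /multicomp_lieSpan Sv; apply: wspan_coords.
  exact: (elimination_lieSpan abG bichar elimE gens_homog generators_positive Sv mN).
Qed.

End Independence.

End FreeBasis.

(** * Witt numbers and parity *)

Section WittNumbers.

Variable r : nat.
Local Notation weight := 'X_{1..r}.
Implicit Types (m w : weight).

(** The greatest common divisor of the components of [m]; it is positive unless [m] is
    zero. *)
Definition wgcd m : nat := \big[gcdn/0%N]_(i < r) m i.

(** Componentwise quotient, meaningful when [n] divides [m]. *)
Definition wdiv m (n : nat) : weight := [multinom (m i %/ n)%N | i < r].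

Lemma dvdn_wgcd n m : reflect (forall i, n %| m i)%N (n %| wgcd m)%N.
Proof.
by apply: (iffP (dvdn_biggcdP _ _ _)) => [H i|H i _]; exact: H.
Qed.

Lemma wgcd_gt0 m : m != 0%MM -> (0 < wgcd m)%N.
Proof.
apply: contraNT; rewrite -eqn0Ngt => /eqP D0; apply/eqP/mnmP => i; rewrite mnm0E.
by apply/eqP; rewrite -dvd0n; move: i; apply/dvdn_wgcd; rewrite D0.
Qed.

Lemma wdivM m a b : wdiv (wdiv m a) b = wdiv m (a * b).
Proof. by apply/mnmP => i; rewrite !mnmE divnMA. Qed.

Lemma wdiv1 m : wdiv m 1 = m.
Proof. by apply/mnmP => i; rewrite mnmE divn1. Qed.

Lemma wgcd_wdiv m n : (0 < n)%N -> (n %| wgcd m)%N -> wgcd (wdiv m n) = (wgcd m %/ n)%N.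
Proof.
move=> n0 nD; have nm := elimT (dvdn_wgcd n m) nD.
have H d : (d %| wgcd (wdiv m n))%N = (d %| wgcd m %/ n)%N.
  rewrite dvdn_divRL //; apply/dvdn_wgcd/dvdn_wgcd => h i; have := h i;
    by rewrite mnmE dvdn_divRL.
by apply/eqP; rewrite eqn_dvd H dvdnn -H dvdnn.
Qed.

Lemma wdivK m n : (n %| wgcd m)%N -> (wdiv m n *+ n)%MM = m.
Proof. by move/dvdn_wgcd => nm; apply/mnmP => i; rewrite mulmnE mnmE divnK. Qed.

Lemma mdeg_wdiv m n : (0 < n)%N -> (n %| wgcd m)%N -> mdeg (wdiv m n) = (mdeg m %/ n)%N.
Proof. by move=> n0 nD; rewrite -{2}(wdivK nD) mdegMn mulnK. Qed.

Lemma wdiv_eq0 m n : (n %| wgcd m)%N -> (wdiv m n == 0)%MM -> m == 0%MM.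
Proof.
move=> nD /eqP e; rewrite -(wdivK nD) e; apply/eqP/mnmP => i.
by rewrite mulmnE mnm0E.
Qed.

Lemma wgcd_dvd_mdeg m : (wgcd m %| mdeg m)%N.
Proof. by rewrite mdegE; apply: dvdn_sum => i _; apply: (elimT (dvdn_wgcd _ m)). Qed.

Lemma sum_divisors_range (V : nmodType) (D N : nat) (f : nat -> V) :
  (0 < D)%N -> (D <= N)%N ->
  \sum_(1 <= j < N.+1 | (j %| D)%N) f j = \sum_(d <- divisors D) f d.
Proof.
move=> D0 DN; rewrite -big_filter; apply: perm_big; apply: uniq_perm.
- by rewrite filter_uniq ?iota_uniq.
- exact: divisors_uniq.
move=> d; rewrite mem_filter mem_index_iota mem_divisors // ltnS.
case: (boolP (d %| D)%N) => //= dD.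
by rewrite (dvdn_gt0 D0 dD) (leq_trans (dvdn_leq D0 dD)).
Qed.

Variables (N : nat) (s : 'I_r -> nat) (ws : seq weight).
Hypothesis ws_pos : forall w, w \in ws -> (0 < mdeg w)%N.
Hypothesis ws_factors : eqN N (1 - linear_form s) (factors ws).

Lemma word_count_divisors m : m != 0%MM -> (mdeg m <= N)%N ->
  word_count s m = \sum_(d <- divisors (wgcd m))
    (mdeg (wdiv m d))%:R * (count_mem (wdiv m d) ws)%:R.
Proof.
move=> m0 mN; have D0 := wgcd_gt0 m0.
have md0 : (0 < mdeg m)%N by rewrite lt0n mdeg_eq0.
rewrite -(logder_word_count ws_pos ws_factors mN m0) (mcoeff_logder _ _ ws_pos).
rewrite -(@sum_divisors_range _ _ N) ?(leq_trans (dvdn_leq md0 (wgcd_dvd_mdeg m))) //.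
rewrite exchange_big /= [RHS]big_mkcond /=; apply: eq_big_nat => j /andP[j0 _].
case: ifPn => [jD|jND].
  rewrite (eq_bigr (fun w => (mdeg (wdiv m j))%:R * (w == wdiv m j)%:R)); last first.
    move=> w _; have -> : (w *+ j == m)%MM = (w == wdiv m j).
      apply/eqP/eqP => [<-|->]; last exact: wdivK.
      by apply/mnmP => i; rewrite mnmE mulmnE mulnK.
    by case: eqP => [->|]; rewrite ?mulr1 ?mulr0.
  rewrite -mulr_sumr -natr_sum; congr (_ * _%:R).
  by rewrite -sum1_count [RHS]big_mkcond; apply: eq_bigr => w _ /=; case: (w == _).
rewrite big1 // => w _; case: eqP => // e; case/negP: jND; apply/dvdn_wgcd => i.
by rewrite -e mulmnE dvdn_mull.
Qed.

Lemma witt_inversion m : m != 0%MM -> (mdeg m <= N)%N ->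
  \sum_(n <- divisors (wgcd m)) (moebius n)%:~R * word_count s (wdiv m n)
    = (mdeg m)%:R * (count_mem m ws)%:R.
Proof.
move=> m0 mN; have D0 := wgcd_gt0 m0.
pose f d : rat := (mdeg (wdiv m d))%:R * (count_mem (wdiv m d) ws)%:R.
rewrite -[in RHS](wdiv1 m) -[RHS]/(f 1%N) -(moebius_inversion f D0).
apply: eq_big_seq => n; rewrite mem_divisors // => nD; congr (_ * _).
have n0 := dvdn_gt0 D0 nD.
rewrite word_count_divisors ?wgcd_wdiv //.
- by apply: eq_bigr => d _; rewrite /f wdivM.
- by apply: contraNN m0; exact: wdiv_eq0.
- by rewrite mdeg_wdiv // (leq_trans (leq_div _ _)).
Qed.

(** For [a = |m|_-] and [ws] the weights of the eliminated elements, the signed Witt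
    formula counts the eliminated elements of weight [m], and those of weight [m / 2]
    when these are odd. *)
Lemma witt_formula m (a : nat) : m != 0%MM -> (mdeg m <= N)%N -> (wgcd m %| a)%N ->
  (-1) ^+ a / (mdeg m)%:R *
     (\sum_(n <- divisors (wgcd m))
        (moebius n)%:~R * ((-1) ^+ (a %/ n) * word_count s (wdiv m n)))
  = (count_mem m ws)%:R +
    (if (2 %| wgcd m)%N && odd (a %/ 2) then (count_mem (wdiv m 2) ws)%:R else 0).
Proof.
move=> m0 mN Da; have D0 := wgcd_gt0 m0.
have d0 : (mdeg m)%:R != 0 :> rat by rewrite pnatr_eq0 mdeg_eq0.
rewrite mulrAC (signed_moebius_sum _ D0 Da) witt_inversion //.
apply: (mulIf d0); rewrite mulfVK // [RHS]mulrDl [_%:R * _]mulrC; congr (_ + _).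
case: ifP => [/andP[D2 _]|_]; last by rewrite mul0r.
have m20 : wdiv m 2 != 0%MM by apply: contraNN m0; exact: wdiv_eq0.
have m2N : (mdeg (wdiv m 2) <= N)%N by rewrite mdeg_wdiv // (leq_trans (leq_div _ _)).
have := witt_inversion m20 m2N; rewrite wgcd_wdiv //.
under eq_bigr do rewrite wdivM.
move=> ->; rewrite mulrA mulrC; congr (_ * _).
rewrite -natrM mulnC mdeg_wdiv // divnK //.
exact: dvdn_trans D2 (wgcd_dvd_mdeg m).
Qed.

End WittNumbers.

Section Parity.

Variables (F : fieldType) (gT : finGroupType) (gamma : gT -> gT -> F).
Hypothesis bichar : color_bicharacter gamma.

Lemma gamma_diagM a b : gamma (a * b)%g (a * b)%g = gamma a a * gamma b b.
Proof.
rewrite (bicharMl bichar) !(bicharMr bichar).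
by rewrite mulrA -[_ * _ * gamma b a]mulrA (bichar_skew bichar) mulr1.
Qed.

(** [G_+] is a subgroup and [G_-], unless empty, is a coset of it. *)
Lemma card_Gplus_Gminus : Gminus gamma != set0 -> #|Gminus gamma| = #|Gplus gamma|.
Proof.
case/set0Pn => h hm.
have sq : gamma h h * gamma h h = 1 by exact: bichar_skew.
have imP : [set (h * x)%g | x in Gplus gamma] \subset Gminus gamma.
  apply/subsetP => y /imsetP[x]; rewrite /Gplus inE => /eqP xp ->.
  by have := hm; rewrite !inE gamma_diagM xp mulr1.
have imM : [set (h * x)%g | x in Gminus gamma] \subset Gplus gamma.
  apply/subsetP => y /imsetP[x] /(gamma_minus bichar) xm ->.
  by rewrite !inE gamma_diagM xm (gamma_minus bichar hm) mulrNN mulr1.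
apply/eqP; rewrite eqn_leq.
have := subset_leq_card imP; have := subset_leq_card imM.
by rewrite !card_imset => [->|x y /mulgI|x y /mulgI] //.
Qed.

Variables (k r : nat) (g : 'I_r -> gT).
Hypothesis g_plus : forall i : 'I_r, (i < k)%N -> g i \in Gplus gamma.
Hypothesis g_minus : forall i : 'I_r, (k <= i)%N -> g i \in Gminus gamma.

Lemma gamma_gdeg m : gamma (gdeg g m) (gdeg g m) = (-1) ^+ (\sum_(i < r | (k <= i)%N) m i)%N.
Proof.
have d1 : gamma 1%g 1%g = 1 by exact: gamma1l.
have dX a j : gamma (a ^+ j)%g (a ^+ j)%g = gamma a a ^+ j.
  by elim: j => [|j IH]; rewrite ?expg0 // expgS gamma_diagM IH exprS.
rewrite /gdeg (big_morph (fun a => gamma a a) gamma_diagM d1).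
rewrite -prodrXr [RHS]big_mkcond; apply: eq_bigr => i _; rewrite dX.
case: leqP => [/g_minus/(gamma_minus bichar)->//|/g_plus].
by rewrite inE => /eqP->; rewrite expr1n.
Qed.

(** The parity of a multidegree is the parity of its [|m|_-]; in characteristic 2 both
    sides are false, as [G_-] is empty. *)
Lemma gdeg_minus m :
  (gdeg g m \in Gminus gamma) = odd (\sum_(i < r | (k <= i)%N) m i)%N.
Proof.
rewrite !inE gamma_gdeg -signr_odd; case: (boolP (odd _)) => [o|]; last by rewrite expr0 eqxx.
rewrite expr1.
have [i ki] : exists i : 'I_r, (k <= i)%N.
  apply/existsP; apply: contraLR o; rewrite negb_exists => /forallP H.
  by rewrite big_pred0 // => i; apply/negbTE.
by have gm := g_minus ki; have := gm; rewrite !inE (gamma_minus bichar gm) => ->.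
Qed.

End Parity.

(** * The dimension formula *)

Section DimensionFormula.

Variables (F : fieldType) (gT : finGroupType) (gamma : gT -> gT -> F).
Hypotheses (abG : abelian [set: gT]) (bichar : color_bicharacter gamma).
Variables (k r : nat) (g : 'I_r -> gT) (g_bij : bijective g).
Hypothesis g_plus : forall i : 'I_r, (i < k)%N -> g i \in Gplus gamma.
Hypothesis g_minus : forall i : 'I_r, (k <= i)%N -> g i \in Gminus gamma.
Variables (X : finType) (deg : X -> gT) (s : 'I_r -> nat).
Hypothesis card_X : forall i : 'I_r, #|[set x : X | deg x == g i]| = s i.
Variables (L : colorLieSuper gamma) (iota : X -> L).
Hypothesis L_free : is_free_cls deg iota.

Lemma count_lie_gens (E : seq ('X_{1..r} * L)) m :
  count (fun q => q.1 == m) (lie_gens g E) =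
  (count_mem m (unzip1 E) +
   (if (2 %| wgcd m)%N && odd ((\sum_(i < r | (k <= i)%N) m i) %/ 2)
    then count_mem (wdiv m 2) (unzip1 E) else 0))%N.
Proof.
rewrite /lie_gens count_cat !count_map count_filter; congr (_ + _)%N.
have half w : (w + w)%MM = m ->
    ((\sum_(i < r | (k <= i)%N) m i) %/ 2 = \sum_(i < r | (k <= i)%N) w i)%N.
  move=> <-; rewrite (eq_bigr (fun i => w i * 2))%N -?big_distrl /= ?mulnK // => i _.
  by rewrite mnmDE addnn muln2.
case: ifPn => [/andP[D2 o2]|cond].
  apply: eq_count => -[w x] /=; rewrite (gdeg_minus bichar g_plus g_minus).
  apply/andP/eqP => [[/eqP <- _]|->].
    by apply/mnmP => i; rewrite mnmE mnmDE addnn -muln2 mulnK.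
  have e : (wdiv m 2 + wdiv m 2)%MM = m by rewrite -[RHS](wdivK D2) mulmS mulm1n.
  by rewrite e eqxx -(half _ e).
apply/eqP; rewrite eqn0Ngt -has_count; apply: contra cond.
case/hasP => -[w x] _ /= /andP[/eqP e]; rewrite (gdeg_minus bichar g_plus g_minus).
rewrite -(half _ e) => ->; rewrite andbT; apply/dvdn_wgcd => i.
by rewrite -e mnmDE addnn -muln2 dvdn_mull.
Qed.

Lemma dimension_formula (alpha : {ffun 'I_r -> nat}) : alpha <> [ffun => 0%N] ->
  exists d : nat,
    has_dim (multicomp g deg iota alpha) d /\
    d%:R = (-1) ^+ mabs_minus k alpha / (mabs alpha)%:R *
      \sum_(1 <= n < (mabs alpha).+1 | mdvd n alpha)
        (moebius n)%:~R *
        (((mabs alpha %/ n)`!)%:R * (-1) ^+ (mabs_minus k alpha %/ n)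
           / (\prod_(i < r) ((alpha i %/ n)`!)%:R)) *
        \prod_(i < r) (s i)%:R ^+ (alpha i %/ n) :> rat.
Proof.
move=> alpha0; have [ginv gK ginvK] := g_bij.
set m := to_weight alpha; set N := mabs alpha; set a := mabs_minus k alpha.
have mE i : m i = alpha i by rewrite mnmE.
have m0 : m != 0%MM.
  apply/eqP => e; apply: alpha0; apply/ffunP => i.
  by rewrite ffunE -mE e mnm0E.
have mN : mdeg m = N by rewrite mdegE; apply: eq_bigr => i _; rewrite mE.
have N0 : (0 < N)%N by rewrite -mN lt0n mdeg_eq0.
have aE : a = (\sum_(i < r | (k <= i)%N) m i)%N by apply: eq_bigr => i _; rewrite mE.
have Da : (wgcd m %| a)%N.
  by rewrite aE; apply: dvdn_sum => i _; apply: (elimT (dvdn_wgcd _ m)).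
have [iota_deg univ] := L_free.
have hom := generators_homog ginvK iota_deg.
have [E elE] := elimination_exists (@generators_positive _ _ _ _ ginv _ deg _ iota)
  (generators_bounded (deg := deg) (iota := iota) (ginv := ginv) N0).
(* The universal property maps the free algebra to matrices acting on words. *)
pose M := mxColor abG bichar (word_deg deg (N := N)).
have [f [[f_comp f_br] f_gen _]] := univ M (fun x => lmul F N x) (@lmul_comp F _ _ deg N).
have {}f_br h h' x y : cls_comp h x -> cls_comp h' y ->
    f (cls_br x y) = f x *m f y - gamma h h' *: (f y *m f x).
  move=> hx hy; rewrite f_br.
  exact: (mx_br_comp gamma (f_comp _ _ hx) (f_comp _ _ hy)).
exists (count (fun q => q.1 == m) (lie_gens g E)); split.
  apply: (multicomp_has_dim abG bichar gK ginvK card_X N0 elE hom f_br f_gen).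
  by rewrite mN.
rewrite count_lie_gens -aE natrD.
have pos : forall w, w \in unzip1 E -> (0 < mdeg w)%N.
  exact: (elim_unzip_positive abG N0 elE hom).
have fac := elim_factors gK ginvK card_X elE.
have mleN : (mdeg m <= N)%N by rewrite mN.
have -> : (if (2 %| wgcd m)%N && odd (a %/ 2) then count_mem (wdiv m 2) (unzip1 E) else 0%N)%:R
   = (if (2 %| wgcd m)%N && odd (a %/ 2) then (count_mem (wdiv m 2) (unzip1 E))%:R else 0) :> rat.
  by case: ifP.
rewrite -(witt_formula pos fac m0 mleN Da) mN; congr (_ * _).
have md0 : (0 < mdeg m)%N by rewrite mN.
have D0 := wgcd_gt0 m0.
rewrite -(@sum_divisors_range _ _ N) //; last first.
  by rewrite -mN dvdn_leq ?wgcd_dvd_mdeg.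
apply: eq_big => [n|n nD].
  by apply/dvdn_wgcd/forallP => nD i; have := nD i; rewrite mE.
have -> : word_count s (wdiv m n) = ((N %/ n)`!)%:R
    / (\prod_(i < r) ((alpha i %/ n)`!)%:R) * \prod_(i < r) (s i)%:R ^+ (alpha i %/ n).
  rewrite /word_count mdeg_wdiv ?(dvdn_gt0 D0) // mN.
  by congr (_ / _ * _); apply: eq_bigr => i _; rewrite mnmE mE.
by rewrite -[RHS]mulrA; congr (_ * _); rewrite !mulrA [(-1) ^+ _ * _]mulrC.
Qed.

End DimensionFormula.

Theorem corollary2p4p4
  (F : fieldType) (gT : finGroupType) (gamma : gT -> gT -> F)
  (abG : abelian [set: gT]) (bichar : color_bicharacter gamma)
  (k r : nat) (le_k_r : (k <= r)%N)
  (g : 'I_r -> gT) (g_bij : bijective g)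
  (g_plus : forall i : 'I_r, (i < k)%N -> g i \in Gplus gamma)
  (g_minus : forall i : 'I_r, (k <= i)%N -> g i \in Gminus gamma)
  (X : finType) (deg : X -> gT) (s : 'I_r -> nat)
  (card_X : forall i : 'I_r, #|[set x : X | deg x == g i]| = s i)
  (s_ge1 : forall i : 'I_r, (1 <= s i)%N)
  (L : colorLieSuper gamma) (iota : X -> L) (L_free : is_free_cls deg iota) :
  [/\ r = k \/ r = (2 * k)%N,
      forall alpha : {ffun 'I_r -> nat}, alpha <> [ffun => 0%N] ->
        exists d : nat,
          has_dim (multicomp g deg iota alpha) d /\
          d%:R = (-1) ^+ mabs_minus k alpha / (mabs alpha)%:R *
            \sum_(1 <= n < (mabs alpha).+1 | mdvd n alpha)
              (moebius n)%:~R *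
              (((mabs alpha %/ n)`!)%:R * (-1) ^+ (mabs_minus k alpha %/ n)
                 / (\prod_(i < r) ((alpha i %/ n)`!)%:R)) *
              \prod_(i < r) (s i)%:R ^+ (alpha i %/ n) :> rat
    & #|[set: gT]| = 1%N ->
        [/\ r = 1%N, k = 1%N
          & forall (i : 'I_r) (n : nat), (1 <= n)%N ->
              exists d : nat,
                has_dim (multicomp g deg iota [ffun => n]) d /\
                d%:R = n%:R^-1 *
                  \sum_(m <- divisors n)
                    (moebius m)%:~R * (s i)%:R ^+ (n %/ m) :> rat]].
Proof.
have formula := dimension_formula abG bichar g_bij g_plus g_minus card_X L_free.
have rE : #|gT| = r by rewrite -[RHS]card_ord; apply/esym/(bij_eq_card g_bij).
have kE : #|Gplus gamma| = k.
  have -> : Gplus gamma = g @: [set i : 'I_r | (i < k)%N].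
    have [ginv gK ginvK] := g_bij; apply/setP => x; apply/idP/imsetP => [xp|[i]].
      exists (ginv x); rewrite ?ginvK // inE ltnNge; apply/negP => /g_minus.
      by rewrite ginvK /Gminus inE xp.
    by rewrite inE => /g_plus ? ->.
  rewrite card_imset; last exact: bij_inj.
  by rewrite -sum1dep_card (big_ord_narrow le_k_r) sum1_card card_ord.
split=> //.
- have := cardsC (Gplus gamma); rewrite rE kE -/(Gminus gamma).
  have [->|/(card_Gplus_Gminus bichar)->] := eqVneq (Gminus gamma) set0.
    by rewrite cards0 addn0; left.
  by rewrite kE addnn -mul2n; right.
rewrite cardsT rE => r1.
have k1 : k = 1%N.
  apply/eqP; rewrite eqn_leq -{1}r1 le_k_r -kE card_gt0.
  by apply/set0Pn; exists 1%g; rewrite inE (gamma1l bichar).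
split=> // i n n0; move: i; clear rE kE; subst r k => i.
have [|d [hd dE]] := formula [ffun => n].
  by move/ffunP/(_ i); rewrite !ffunE => n_eq0; rewrite n_eq0 in n0.
exists d; split=> //; rewrite dE.
have -> : mabs ([ffun=> n] : {ffun 'I_1 -> nat}) = n by rewrite /mabs big_ord1 ffunE.
have -> : mabs_minus 1 ([ffun=> n] : {ffun 'I_1 -> nat}) = 0%N.
  by rewrite /mabs_minus big_pred0 // => j; rewrite leqNgt ltn_ord.
rewrite expr0 mul1r; congr (_ * _).
rewrite -(sum_divisors_range _ n0 (leqnn n)).
apply: eq_big => [m|m _].
  by apply/forallP/idP => [/(_ i)|mn j]; rewrite ffunE.
rewrite !big_ord1 ffunE div0n expr0 mulr1 (ord1 i) divff ?mulr1 //.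
by rewrite pnatr_eq0 -lt0n fact_gt0.
Qed.
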